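(* Fix $d\ge1$. Consider the maximum, over all discrete multicriteria optimization problems with $d$ objectives and exactly $n$ nondominated points, of the number of scalarizations (calls to the oracle NextNonDominated) performed by the Nondominated Set Algorithm described in the context. As a function of $n$, this maximum lies in $\Theta(n^{\lfloor d/2\rfloor})$.
   Context: A multicriteria optimization problem with $d$ objectives is given by its outcome space $Z\subseteq\mathbb{R}^d$. A point $z\in Z$ is nondominated if there is no $w\in Z$ with $w_i\le z_i$ for all $i\in[d]=\{1,\dots,d\}$ and $w_\ell<z_\ell$ for at least one $\ell$. The problem is discrete if its set of nondominated points is finite and nonempty. $\mathbb{T}_{\min}=\mathbb{R}\cup\{\infty\}$ with tropical addition $\min$ and tropical multiplication $+$; $\mathbb{T}_{\max}=\mathbb{R}\cup\{-\infty\}$. Both carry the order topology, and powers the product topology. Coordinates in $\mathbb{T}_{\min}^{d+1}$, $\mathbb{T}_{\max}^{d+1}$ are indexed by $0,\dots,d$. $\operatorname{supp}(a)$ is the set of indices $i$ with $a_i\neq\infty$ (for $a\in\mathbb{T}_{\min}^{d+1}$), respectively $a_i\neq-\infty$ (for $a\in\mathbb{T}_{\max}^{d+1}$). A $\min$-tropical cone is a nonempty $C\subseteq\mathbb{T}_{\min}^{d+1}$ such that $(\min(\lambda+x_i,\mu+y_i))_i\in C$ for all $x,y\in C$, $\lambda,\mu\in\mathbb{T}_{\min}$. A set generates $C$ if $C$ is the smallest $\min$-tropical cone containing it. A finitely generated cone has an inclusion-minimal generating set, unique up to tropical scaling (adding real multiples of the all-ones vector $\mathbf{1}$); its elements are the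 extremal generators. $e^{(i)}\in\mathbb{T}_{\min}^{d+1}$ has $i$-th entry $0$ and all others $\infty$; $\mathcal{E}_{\min}=\{e^{(1)},\dots,e^{(d)}\}$. For finite $G\subset\mathbb{T}_{\max}^{d+1}$ with $0\in\operatorname{supp}(g)$ for all $g\in G$, let $M(G)=\bigcup_{g\in G}\{x\in\mathbb{R}^{d+1} : x_0-g_0\le\min(x_j-g_j\mid j\in\operatorname{supp}(g)\setminus\{0\})\}$; let $W(G)$ be the closure in $\mathbb{R}^{d+1}$ of $\mathbb{R}^{d+1}\setminus M(G)$, and $\overline{W}(G)$ the closure of $W(G)$ in $\mathbb{T}_{\min}^{d+1}$; for the sets $G$ occurring here it is a finitely generated $\min$-tropical cone. Points of $\mathbb{R}^d$ are identified with points of $\mathbb{R}^{d+1}$ with $0$th coordinate $0$. Extremal generators of $\overline{W}(G)$ with finite $0$th coordinate are always normalized to have $0$th coordinate $0$; those with $0$th coordinate $\infty$ are the elements of $\mathcal{E}_{\min}$. Subroutine NewExtremals$(G,A,h)$, where $A$ is the set of extremal generators of $\overline{W}(G)$ and $h\in\mathbb{R}^{d+1}$ with $h_0=0$: let $A^{\ge}=\{a\in A : a_0\ge\min_{i\in[d]}(a_i-h_i)\}$ and start with $B=A^{\ge}$. For every pair $b\in A^{\ge}$, $c\in A\setminus A^{\ge}$, set $\lambda=-\min_{i\in[d]}(b_i-h_i)$ and $a=\min(\lambda\mathbf{1}+b,\,c)$ (componentwise); if $a$ is an extremal generator of $\overline{W}(G\cup\{h\})$, add $(0,a_1-a_0,\dots,a_d-a_0)$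 to $B$. Return $B$ (this is the set of extremal generators of $\overline{W}(G\cup\{h\})$). Oracle NextNonDominated$(Z,a)$, for $a\in\mathbb{T}_{\min}^{d+1}$ with $a_0=0$: returns some nondominated point $z$ of $Z$ with $z_j<a_j$ for all $j\in\operatorname{supp}(a)\setminus\{0\}$ if such a point exists, and None otherwise. Each call counts as one scalarization. Nondominated Set Algorithm: initialize $A=\mathcal{E}_{\min}\cup\{e^{(0)}\}$, $G=\emptyset$, $\Omega=\mathcal{E}_{\min}$. While $A\ne\Omega$: pick any $a\in A\setminus\Omega$; let $g=$ NextNonDominated$(Z,a)$; if $g\ne$ None, replace $A$ by NewExtremals$(G,A,g)$ and then $G$ by $G\cup\{g\}$; otherwise replace $\Omega$ by $\Omega\cup\{a\}$. Finally return $G$. The maximum is considered only for those $n$ for which a discrete problem with exactly $n$ nondominated points exists (for $d=1$ only $n=1$). *)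

(* Defs.v *)
From HB Require Import structures.
From mathcomp Require Import all_boot all_order all_algebra.
From mathcomp Require Import all_classical all_reals all_analysis.

Set Implicit Arguments.
Unset Strict Implicit.
Unset Printing Implicit Defensive.

Import Order.TTheory GRing.Theory Num.Theory.
Import numFieldNormedType.Exports.

Local Open Scope classical_set_scope.
Local Open Scope ring_scope.

(* Vectors with d+1 coordinates are row vectors indexed by 'I_d.+1; the
   coordinate i in [d] = {1, ..., d} is lift ord0 i with i : 'I_d.
   Both T_min = R u {+oo} and T_max = R u {-oo} are represented inside the
   extended reals \bar R.  Since they are rays of \bar R, their order topology
   is the subspace topology of the (order) topology of \bar R, and row vectors
   carry the product topology. *)

Section Problems.
Context {R : realType} {d : nat}.
Implicit Types (Z : set 'rV[R]_d) (z w : 'rV[R]_d).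

Definition nondominated Z : set 'rV[R]_d :=
  [set z | Z z /\ ~ exists w, [/\ Z w, forall i, w ord0 i <= z ord0 i
                                & exists l, w ord0 l < z ord0 l]].

Definition discrete_problem Z : Prop :=
  finite_set (nondominated Z) /\ nondominated Z !=set0.

Definition discrete_with Z (n : nat) : Prop :=
  discrete_problem Z /\ (nondominated Z #= `I_n)%card.

End Problems.

Section TropicalCones.
Context {R : realType} {m : nat}.
Implicit Types (x y a : 'rV[\bar R]_m) (C S : set 'rV[\bar R]_m).

Definition Tmin : set 'rV[\bar R]_m := [set x | forall i, x ord0 i != -oo%E].

Definition min_comb (la mu : \bar R) x y : 'rV[\bar R]_m :=
  \row_i Order.min (la + x ord0 i)%E (mu + y ord0 i)%E.

Definition min_tropical_cone C : Prop :=
  [/\ C !=set0, C `<=` Tmin &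
      forall x y (la mu : \bar R), C x -> C y -> la != -oo%E -> mu != -oo%E ->
        C (min_comb la mu x y)].

Definition generates S C : Prop :=
  min_tropical_cone C /\ C = smallest min_tropical_cone S.

Definition minimal_generating_set S C : Prop :=
  generates S C /\ forall S', S' `<=` S -> generates S' C -> S' = S.

(* In a finitely generated cone, inclusion-minimal generating sets are unique
   up to scaling of their elements, so this is the set of extremal generators with all their real
   scalings. *)
Definition extremal_generator C a : Prop :=
  exists2 S, minimal_generating_set S C & S a.

Definition tunit (k : 'I_m) : 'rV[\bar R]_m :=
  \row_i (if i == k then 0%E else +oo%E).

Definition real_to_ext (x : 'rV[R]_m) : 'rV[\bar R]_m := map_mx EFin x.

End TropicalCones.

Section Algorithm.
Context {R : realType} {d : nat}.
Implicit Types (G A : set 'rV[\bar R]_d.+1) (a b c g : 'rV[\bar R]_d.+1).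
Implicit Types (Z : set 'rV[R]_d).

Definition point (z : 'rV[R]_d) : 'rV[R]_d.+1 :=
  \row_j (if unlift ord0 j is Some i then z ord0 i else 0).

Definition tmax_point (z : 'rV[R]_d) : 'rV[\bar R]_d.+1 :=
  real_to_ext (point z).

Definition Emin : set 'rV[\bar R]_d.+1 :=
  [set tunit (lift ord0 i) | i in [set: 'I_d]].

(* The elements of G are vectors over T_max, with 0 in their support; the
   inequality with the minimum over supp(g) \ {0} is spelled out coordinatewise
   (the minimum of the empty family being +oo). *)
Definition Mset G : set 'rV[R]_d.+1 :=
  \bigcup_(g in G) [set x | forall j : 'I_d.+1,
    j != ord0 -> g ord0 j != -oo%E ->
    ((x ord0 ord0)%:E - g ord0 ord0 <= (x ord0 j)%:E - g ord0 j)%E].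

Definition Wset G : set 'rV[R]_d.+1 := closure (~` Mset G).

Definition Wbar G : set 'rV[\bar R]_d.+1 :=
  closure (real_to_ext @` Wset G) `&` Tmin.

Definition min_diff b (h : 'rV[R]_d.+1) : \bar R :=
  \big[Order.min/+oo%E]_(i < d)
    (b ord0 (lift ord0 i) - (h ord0 (lift ord0 i))%:E)%E.

Definition Age A (h : 'rV[R]_d.+1) : set 'rV[\bar R]_d.+1 :=
  [set a | A a /\ (min_diff a h <= a ord0 ord0)%E].

Definition dehomogenize a : 'rV[\bar R]_d.+1 :=
  \row_j (if j == ord0 then 0%E else (a ord0 j - a ord0 ord0)%E).

Definition new_extremals G A (h : 'rV[R]_d.+1) : set 'rV[\bar R]_d.+1 :=
  Age A h `|`
  [set e | exists b c,
     let a := min_comb (- min_diff b h)%E 0%E b c in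
     [/\ Age A h b, (A `\` Age A h) c,
         extremal_generator (Wbar (G `|` [set real_to_ext h])) a &
         e = dehomogenize a]].

Definition oracle_answer Z a (z : 'rV[R]_d) : Prop :=
  nondominated Z z /\
  forall i : 'I_d, a ord0 (lift ord0 i) != +oo%E ->
    ((z ord0 i)%:E < a ord0 (lift ord0 i))%E.

Definition is_NextNonDominated
    (oracle : set 'rV[R]_d -> 'rV[\bar R]_d.+1 -> option 'rV[R]_d) : Prop :=
  forall Z a, Tmin a -> a ord0 ord0 = 0%E ->
    if oracle Z a is Some z then oracle_answer Z a z
    else ~ exists z, oracle_answer Z a z.

Record state := State {
  stA : set 'rV[\bar R]_d.+1;
  stG : set 'rV[R]_d;
  stOmega : set 'rV[\bar R]_d.+1 }.

(* The choice "pick any a in A \ Omega" may depend on the problem and on the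
   whole current state. *)
Definition is_pick_rule
    (pick : set 'rV[R]_d -> state -> 'rV[\bar R]_d.+1) : Prop :=
  forall Z s, stA s `\` stOmega s !=set0 ->
    (stA s `\` stOmega s) (pick Z s).

Definition init_state : state :=
  State (Emin `|` [set tunit ord0]) set0 Emin.

(* One pass through the body of the loop, hence one call to the oracle. *)
Definition nda_step
    (pick : set 'rV[R]_d -> state -> 'rV[\bar R]_d.+1)
    (oracle : set 'rV[R]_d -> 'rV[\bar R]_d.+1 -> option 'rV[R]_d)
    Z (s : state) : state :=
  let a := pick Z s in
  if oracle Z a is Some g
  then State (new_extremals (tmax_point @` stG s) (stA s) (point g))
             (stG s `|` [set g]) (stOmega s)
  else State (stA s) (stG s) (stOmega s `|` [set a]).

(* The algorithm terminates on Z after exactly k oracle calls. *)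
Definition scalarizations
    (pick : set 'rV[R]_d -> state -> 'rV[\bar R]_d.+1)
    (oracle : set 'rV[R]_d -> 'rV[\bar R]_d.+1 -> option 'rV[R]_d)
    Z (k : nat) : Prop :=
  let st j := iter j (nda_step pick oracle Z) init_state in
  (forall j, (j < k)%N -> stA (st j) <> stOmega (st j)) /\
  stA (st k) = stOmega (st k).

Definition is_max_scalarizations
    (pick : set 'rV[R]_d -> state -> 'rV[\bar R]_d.+1)
    (oracle : set 'rV[R]_d -> 'rV[\bar R]_d.+1 -> option 'rV[R]_d)
    (n m : nat) : Prop :=
  (exists2 Z, discrete_with Z n & scalarizations pick oracle Z m) /\
  (forall Z, discrete_with Z n ->
     exists2 k, scalarizations pick oracle Z k & (k <= m)%N).

End Algorithm.

Arguments state R d : clear implicits.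

Definition admissible (R : realType) (d n : nat) : Prop :=
  exists Z : set 'rV[R]_d, discrete_with Z n.

(* f is in Theta(g) for functions with domain D.  No threshold on n is needed:
   it can be absorbed in the constants as soon as f and g are positive on D,
   and without it the notion remains meaningful for a finite D. *)
Definition Theta_on (R : realType) (D : set nat) (f g : nat -> nat) : Prop :=
  exists c1 c2 : R, [/\ 0 < c1, 0 < c2 &
    forall n, D n ->
      c1 * (g n)%:R <= (f n)%:R /\ (f n)%:R <= c2 * (g n)%:R].

(* Main.v *)
(* The finite extremal generators of the cone of [G] are its local upper bounds,
   the maximal points [a] such that no point of [G] is strictly below [a] in all
   coordinates. Each call to the oracle either finds a new nondominated point or
   certifies one local upper bound for good, so a run on [n] nondominated points
   takes [n] calls plus one call for each local upper bound of the nondominated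
   set.

   For the upper bound on their number, ties are broken and the coordinates are
   replaced by ranks [r]. With [t] large, the local upper bounds become vertices
   of the polyhedron cut out by the inequalities [\sum_j t ^ r_j(g) y_j >= 1], and
   each of them lies on [d] of its facets. Seidel's argument applies: a generic
   linear functional increases or decreases along at least half of the [d] edges
   at a vertex, so that the vertex is determined by at most [d / 2] of its facets.

   The lower bound is attained by distributing the points over [d / 2] planar
   staircases in disjoint pairs of coordinates: the gaps in the staircases can be
   chosen independently. *)

Require Import Defs.
From mathcomp Require Import all_boot all_order all_algebra.
From mathcomp Require Import all_classical all_reals all_analysis.
From mathcomp Require Import finmap lra zify.

Set Implicit Arguments.
Unset Strict Implicit.
Unset Printing Implicit Defensive.

Import Order.TTheory GRing.Theory Num.Theory.
Import numFieldNormedType.Exports.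

Local Open Scope ring_scope.

(** * Seidel's bound on the number of vertices *)

Section GenericFunctional.
Context {F : realFieldType}.

Lemma ex_nonroot (p : {poly F}) : p != 0 -> exists s, ~~ root p s.
Proof.
move=> p0; apply: contrapT => no.
have rt (s : F) : root p s by apply: contrapT => /negP ns; apply: no; exists s.
(* The naturals below [size p] are distinct in [F], one more than the degree of [p]. *)
pose rs : seq F := [seq i%:R | i <- iota 0 (size p)].
have rs_root : all (root p) rs by apply/allP => s _.
have rs_uniq : uniq rs.
  by rewrite map_inj_uniq ?iota_uniq// => i j /eqP; rewrite eqr_nat => /eqP.
by have := max_poly_roots p0 rs_root rs_uniq; rewrite size_map size_iota ltnn.
Qed.

(* The functional is taken on the moment curve [s |-> (1, s, s^2, ...)]. *)
Lemma ex_generic_functional (I : finType) (d : nat) (c : I -> 'cV[F]_d) :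
  (forall i, c i != 0) -> exists w : 'rV[F]_d, forall i, (w *m c i) 0 0 != 0.
Proof.
move=> c0.
(* With the entries of [c i] read as polynomial coefficients, applying the functional becomes
   evaluation at [s], so [s] only has to avoid the roots of one nonzero product. *)
have p0 i : rVpoly (c i)^T != 0.
  apply: contra_neq (c0 i) => pi0; apply: trmx_inj; rewrite trmx0.
  by rewrite -[LHS]rVpolyK pi0 raddf0.
have /ex_nonroot[s] : \prod_i rVpoly (c i)^T != 0 by apply/prodf_neq0 => i _.
rewrite /root horner_prod => /prodf_neq0 ps.
exists (\row_k s ^+ k) => i; have := ps i isT.
congr (_ != _); rewrite (horner_coef_wide _ (size_poly _ _)) mxE.
by apply: eq_bigr => k _; rewrite coef_rVpoly_ord !mxE mulrC.
Qed.

End GenericFunctional.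

Section SimpleVertices.
Context {F : realFieldType} {d : nat} {X V : finType}.
Context (a : X -> 'rV[F]_d) (kappa : V -> 'I_d -> X) (y : V -> 'cV[F]_d).

Definition contact_mx (v : V) : 'M[F]_d := \matrix_(i, k) a (kappa v i) 0 k.

Context (contact_unit : forall v, contact_mx v \in unitmx).
Context (contactP : forall v i, (a (kappa v i) *m y v) 0 0 = 1).
Context (y_feasible : forall v x, 1 <= (a x *m y v) 0 0).
Context (y_inj : injective y).

Lemma contact_mulE v (z : 'cV[F]_d) i :
  (contact_mx v *m z) i 0 = (a (kappa v i) *m z) 0 0.
Proof. by rewrite !mxE; apply: eq_bigr => k _; rewrite mxE. Qed.

(* The [i]th column of the inverse contact matrix is the direction of the edge
   of [u] that leaves the [i]th contact row. *)
Lemma vertex_is_face_min (w : 'rV[F]_d) (D : {pred 'I_d}) u v :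
  (forall i, i \in D -> 0 < (w *m invmx (contact_mx u)) 0 i) ->
  (forall i, i \notin D -> kappa u i = kappa v i) ->
  (w *m y u) 0 0 <= (w *m y v) 0 0 ?= iff (u == v).
Proof.
move=> up same.
(* [c] lists the slacks of [y v] in the contact rows of [u]. From [y u] to [y v] the functional
   grows by the sum of these slacks weighted by the edge slopes. *)
pose B := contact_mx u; pose c := B *m (y v - y u).
have cE i : c i 0 = (a (kappa u i) *m y v) 0 0 - 1.
  by rewrite /c mulmxBr [LHS]mxE [X in _ + X]mxE !contact_mulE contactP.
have c_ge0 i : 0 <= c i 0 by rewrite cE subr_ge0.
have c_eq0 i : i \notin D -> c i 0 = 0.
  by move=> iD; rewrite cE same// contactP subrr.
have dw : (w *m y v) 0 0 - (w *m y u) 0 0 =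
    \sum_i (w *m invmx B) 0 i * c i 0.
  transitivity ((w *m (y v - y u)) 0 0).
    by rewrite mulmxBr [RHS]mxE [X in _ = _ + X]mxE.
  have -> : y v - y u = invmx B *m c by rewrite mulKmx ?contact_unit.
  by rewrite mulmxA [LHS]mxE.
have t_ge0 i : 0 <= (w *m invmx B) 0 i * c i 0.
  have [iD|iD] := boolP (i \in D); last by rewrite c_eq0// mulr0.
  by rewrite mulr_ge0// ltW// up.
split; first by rewrite -subr_ge0 dw sumr_ge0.
apply/eqP/eqP => [wE|->//]; apply: y_inj.
have /eqP : \sum_i (w *m invmx B) 0 i * c i 0 = 0 by rewrite -dw wE subrr.
rewrite psumr_eq0// => /allP t0.
have c_0 : c = 0.
  apply/colP => i; rewrite [RHS]mxE.
  have [iD|/c_eq0//] := boolP (i \in D).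
  have := t0 i (mem_index_enum i); rewrite /= mulf_eq0 => /orP[|/eqP//].
  by rewrite gt_eqF ?up.
have : y v - y u = invmx B *m c by rewrite mulKmx ?contact_unit.
by rewrite c_0 mulmx0 => /eqP; rewrite subr_eq0 => /eqP->.
Qed.

(* Seidel's asymptotic upper bound argument: for a generic functional, one half
   of the edges at a vertex point up or one half of them point down, so the
   vertex is the lowest or highest one of a face cut out by at most half of its
   contact rows. *)
Lemma card_simple_vertices (i0 : 'I_d) :
  (#|V| <= 2 * 2 ^ d * #|X| ^ (d %/ 2))%N.
Proof.
have col_neq0 (vi : V * 'I_d) : col vi.2 (invmx (contact_mx vi.1)) != 0.
  case: vi => [v i] /=; apply/negP => /eqP c0.
  have /(congr1 (fun M : 'M[F]_d => M i i)) : contact_mx v *m invmx (contact_mx v) = 1%:M.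
    exact: mulmxV.
  rewrite !mxE eqxx /= big1 => [/esym/eqP|k _]; first by rewrite oner_eq0.
  by have /(congr1 (fun M : 'cV[F]_d => M k 0)) := c0; rewrite 2!mxE => ->; rewrite mxE mulr0.
have [w wP] := ex_generic_functional col_neq0.
pose co v i := (w *m invmx (contact_mx v)) 0 i.
have co_neq0 v i : co v i != 0.
  have := wP (v, i); rewrite /co /= => h; apply: contra h => /eqP h; apply/eqP.
  by rewrite -h !mxE; apply: eq_bigr => k _; rewrite mxE.
pose P v := finset (fun i => 0 < co v i).
(* The set [P v] of ascending edges or its complement has at most [d / 2] elements. The flag [s v]
   tells whether [y v] will be a minimum of [w] or of [- w] on the face cut out by the rows in
   [I v]. *)
pose s v := (#|~: P v| <= d %/ 2)%N.
pose I v := if s v then (~: P v)%SET else P v.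
have card_I v : (#|I v| <= d %/ 2)%N.
  rewrite /I; case: ifPn => //; rewrite /s.
  have := cardsC (P v); rewrite card_ord; lia.
(* Keeping [I v] in the key fixes the order in which its rows are listed; positions beyond
   [enum (I v)] are padded with [i0]. *)
pose key v : bool * {set 'I_d} * {ffun 'I_(d %/ 2) -> X} :=
  (s v, I v, [ffun m : 'I_(d %/ 2) => kappa v (nth i0 (enum (I v)) m)]).
suff key_inj : injective key.
  rewrite (leq_trans (leq_card _ key_inj))//.
  by rewrite !card_prod card_bool card_ffun card_ord -cardsT -powersetT card_powerset cardsT card_ord.
move=> u v [su Iu /ffunP ku].
have same i : i \in I u -> kappa u i = kappa v i.
  move=> iI; have lt : (index i (enum (I u)) < d %/ 2)%N.
    by rewrite (leq_trans _ (card_I u))// cardE index_mem mem_enum.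
  by have := ku (Ordinal lt); rewrite !ffunE /= -Iu nth_index// mem_enum.
have mono u' v' : s u' = s v' -> I u' = I v' ->
    (forall i, i \in I u' -> kappa u' i = kappa v' i) ->
    if s u' then (w *m y u') 0 0 <= (w *m y v') 0 0 ?= iff (u' == v')
    else ((- w) *m y u') 0 0 <= ((- w) *m y v') 0 0 ?= iff (u' == v').
  move=> ss II sm; case: ifPn => sE.
    apply: (@vertex_is_face_min w [pred i | i \notin I u']) => i; last first.
      by rewrite inE negbK => /sm.
    by rewrite inE /I sE !inE negbK.
  apply: (@vertex_is_face_min (- w) [pred i | i \notin I u']) => i; last first.
    by rewrite inE negbK => /sm.
  rewrite inE /I (negPf sE) inE -/(co u' i) => coi.
  rewrite mulNmx mxE oppr_gt0 lt_neqAle leNgt coi andbT; exact: co_neq0.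
(* Each vertex has at most the value of the other for the same functional, so the values agree and
   the equality case identifies the vertices. *)
have := mono u v su Iu same.
have := mono v u (esym su) (esym Iu) _.
rewrite -su -Iu => /(_ (fun i iI => esym (same i iI))).
case: ifP => _ h1 h2; apply/eqP.
- by have := eq_leif h2; rewrite eq_le (h1.1) (h2.1) => <-.
- by have := eq_leif h2; rewrite eq_le (h1.1) (h2.1) => <-.
Qed.

End SimpleVertices.

(** * Maximal rank vectors *)

Section MaximalRanks.
Context {F : realFieldType} {d N : nat} (r : 'I_d -> 'I_N -> nat).
Context (r_lt : forall j p, (r j p < N)%N) (r_inj : forall j, injective (r j)).

(** The value [N] exceeds every rank and stands for an infinite coordinate. *)
Definition rank_free (rho : {ffun 'I_d -> 'I_N.+1}) : bool :=
  [forall p, exists j, (rho j <= r j p)%N].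

Definition rank_maximal (rho : {ffun 'I_d -> 'I_N.+1}) : bool :=
  rank_free rho &&
  [forall rho' : {ffun 'I_d -> 'I_N.+1},
    (rank_free rho' && [forall j, (rho j <= rho' j)%N]) ==> (rho' == rho)].

(* [inr j] stands for a point at infinity on the [j]th axis. *)
Definition is_contact (rho : {ffun 'I_d -> 'I_N.+1}) (j : 'I_d) (x : 'I_N + 'I_d) : bool :=
  match x with
  | inl p => (r j p == rho j) && [forall k, (k != j) ==> (r k p < rho k)%N]
  | inr k => (k == j) && (rho j == N :> nat)
  end.

(** A free vector above [rho] with the largest coordinate sum is maximal. *)
Lemma ex_rank_maximal (rho : {ffun 'I_d -> 'I_N.+1}) : rank_free rho ->
  exists2 rho', rank_maximal rho' & forall j, (rho j <= rho' j)%N.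
Proof.
move=> free.
pose Q (rho' : {ffun 'I_d -> 'I_N.+1}) :=
  rank_free rho' && [forall j, (rho j <= rho' j)%N].
have Q0 : Q rho by rewrite /Q free; apply/forallP.
case: (@arg_maxnP _ rho Q (fun rho' => \sum_j rho' j)%N Q0) => m /andP[mfree /forallP ge] mx.
exists m => //; rewrite /rank_maximal mfree; apply/forallP => rho'.
apply/implyP => /andP[free' /forallP ge'].
have Q' : Q rho'.
  by rewrite /Q free'; apply/forallP => j; apply: leq_trans (ge' j).
have : (\sum_j rho' j <= \sum_j m j)%N := mx rho' Q'.
rewrite leqNgt => nlt; apply/eqP/ffunP => j; apply/val_inj/eqP.
rewrite eqn_leq ge' andbT leqNgt; apply: contra nlt => lt.
rewrite (bigD1 j)//= [X in (_ < X)%N](bigD1 j)//= -addSn leq_add// leq_sum//.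
Qed.

(** If [rho j < N], raising this coordinate by one destroys freeness. The point responsible has rank
    at most [rho j] there, and not less because [rho] is free. *)
Lemma ex_contact rho j : rank_maximal rho -> exists x, is_contact rho j x.
Proof.
move=> /andP[/forallP free /forallP mx].
have [rN|rN] := eqVneq (rho j : nat) N; first by exists (inr j); rewrite /= eqxx rN eqxx.
have rlt : (rho j < N)%N by rewrite ltn_neqAle rN -ltnS ltn_ord.
pose rho' : {ffun 'I_d -> 'I_N.+1} :=
  [ffun k => if k == j then inord (rho j).+1 else rho k].
have rho'j : rho' j = (rho j).+1 :> nat by rewrite ffunE eqxx inordK.
have rho'k k : k != j -> rho' k = rho k by rewrite ffunE => /negPf->.
have : ~~ rank_free rho'.
  apply/negP => free'; have := mx rho'; rewrite free' /= => /implyP.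
  case: forallP => [_ /(_ isT)/eqP e|nle].
    by move: rho'j; rewrite e; lia.
  by case: nle => k; have [->|/rho'k->//] := eqVneq k j; rewrite rho'j.
rewrite negb_forall => /existsP[p]; rewrite negb_exists => /forallP plt.
exists (inl p) => /=.
have ltk k : k != j -> (r k p < rho k)%N.
  by move=> kj; have := plt k; rewrite rho'k// -ltnNge.
apply/andP; split; last by apply/forallP => k; apply/implyP/ltk.
have /existsP[k kle] := free p.
have kj : k = j by apply/eqP/negPn/negP => /ltk; lia.
by have := plt j; rewrite rho'j -ltnNge -{}kj; lia.
Qed.

(** A rank below that of the contact costs at least a factor [t], so fewer than [d] off-diagonal
    terms, each at most [1 / t] after scaling, sum to at most [1 / 4]. *)
Let t : F := (4 * d.+1)%:R.

(** The row of [inr j] encodes the bound [y_j >= t ^ -N], which makes an infinite coordinate a facet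
    like the others. *)
Definition rank_row (x : 'I_N + 'I_d) : 'rV[F]_d :=
  match x with
  | inl p => \row_k t ^+ r k p
  | inr j => \row_k (if k == j then t ^+ N else 0)
  end.

Lemma base_gt1 : 1 < t.
Proof. by rewrite /t ltr1n; lia. Qed.

Lemma base_gt0 : 0 < t.
Proof. exact: lt_trans base_gt1. Qed.

Lemma rank_row_ge0 x k : 0 <= rank_row x 0 k.
Proof.
case: x => [p|j]; rewrite mxE; first by rewrite exprn_ge0// ltW// base_gt0.
by case: ifP => // _; rewrite exprn_ge0// ltW// base_gt0.
Qed.

Lemma contact_diag rho j x : is_contact rho j x -> rank_row x 0 j = t ^+ rho j.
Proof.
case: x => [p|k] /=; first by rewrite mxE => /andP[/eqP->].
by move=> /andP[/eqP-> /eqP->]; rewrite mxE eqxx.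
Qed.

Lemma contact_offdiag rho j x k : is_contact rho j x -> k != j ->
  t * rank_row x 0 k <= t ^+ rho k.
Proof.
case: x => [p|l] /=; rewrite mxE.
  move=> /andP[_ /forallP/(_ k)/implyP lt] /lt {}lt.
  by rewrite -exprS ler_eXn2l// base_gt1.
move=> /andP[/eqP-> _] /negPf->; rewrite mulr0 exprn_ge0// ltW// base_gt0.
Qed.

(* Each row of the contact matrix of [rho] is, after scaling, within [1/4] of a
   unit vector in the l^1 norm. *)
Lemma contact_perturbation rho j x (z : 'cV[F]_d) (m : F) : is_contact rho j x ->
  (forall k, `|t ^+ rho k * z k 0| <= m) ->
  `|(rank_row x *m z) 0 0 - t ^+ rho j * z j 0| <= m / 4.
Proof.
move=> xj zm.
have m0 : 0 <= m by apply: le_trans (zm j).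
rewrite mxE (bigD1 j)//= (contact_diag xj) addrAC subrr add0r.
rewrite (le_trans (ler_norm_sum _ _ _))//.
apply: (@le_trans _ _ (\sum_(k < d | k != j) (m / t))).
  apply: ler_sum => k kj; rewrite ler_pdivlMr ?base_gt0// normrM.
  rewrite (ger0_norm (rank_row_ge0 _ _)) mulrAC.
  apply: le_trans (zm k).
  rewrite normrM (ger0_norm (exprn_ge0 _ (ltW base_gt0))).
  have := ler_wpM2r (normr_ge0 (z k 0)) (contact_offdiag xj kj).
  by rewrite [t * _]mulrC.
rewrite sumr_const -[X in X <= _]mulr_natl.
apply: (@le_trans _ _ (d%:R * (m / t))).
  rewrite ler_pM// ?ler0n ?divr_ge0 ?(ltW base_gt0)// ler_nat.
  by rewrite (leq_trans (max_card _))// card_ord.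
rewrite mulrA ler_pdivrMr ?base_gt0// /t natrM.
have : d%:R <= d.+1%:R :> F by rewrite ler_nat.
by move=> hd; nra.
Qed.

(** If [m] is the largest absolute value of a scaled coordinate [t ^ rho_j * z_j], all of them are
    within [m / 4] of [b]; hence [m <= 4 b / 3]. The case [b = 0] gives invertibility of the contact
    matrix, the case [b = 1] locates the vertex. *)
Lemma contact_solution_bound rho (z : 'cV[F]_d) (x : 'I_d -> 'I_N + 'I_d) (b : F) :
  (forall j, is_contact rho j (x j)) ->
  (forall j, (rank_row (x j) *m z) 0 0 = b) -> 0 <= b ->
  forall j, 2%:R / 3%:R * b <= t ^+ rho j * z j 0 <= 4%:R / 3%:R * b.
Proof.
move=> xc xz b0 j0.
pose f j := `|t ^+ rho j * z j 0|.
case: (@arg_maxP _ _ _ j0 predT f isT) => j1 _ mx.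
have bd j : `|b - t ^+ rho j * z j 0| <= f j1 / 4.
  by rewrite -(xz j) (contact_perturbation (xc j) (fun k => mx k isT)).
have bd' j : b - f j1 / 4 <= t ^+ rho j * z j 0 <= b + f j1 / 4.
  by have := bd j; rewrite ler_norml => /andP[h1 h2]; apply/andP; split; lra.
have f_le : f j1 <= b + f j1 / 4.
  by have /andP[h1 h2] := bd' j1; rewrite ler_norml; apply/andP; split; lra.
by have /andP[h1 h2] := bd' j0; apply/andP; split; lra.
Qed.

Lemma card_rank_maximal (j0 : 'I_d) :
  (#|rank_maximal| <= 2 * 2 ^ d * (N + d) ^ (d %/ 2))%N.
Proof.
pose V := {rho | rank_maximal rho}.
have ex_kappa (v : V) : exists k : 'I_d -> 'I_N + 'I_d,
    forall j, is_contact (sval v) j (k j).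
  by have [k kP] := choice (fun j => ex_contact j (svalP v)); exists k.
have [kappa kappaP] := choice ex_kappa.
have unit (v : V) : contact_mx rank_row kappa v \in unitmx.
  rewrite -unitmx_tr -row_free_unit -kermx_eq0; apply/eqP/row_matrixP => i.
  rewrite row0; set z := row i _.
  have z0 : contact_mx rank_row kappa v *m z^T = 0.
    by apply: trmx_inj; rewrite trmx_mul trmxK trmx0 -row_mul mulmx_ker row0.
  have zz j : (rank_row (kappa v j) *m z^T) 0 0 = 0.
    by rewrite -contact_mulE z0 mxE.
  apply/rowP => j; rewrite [RHS]mxE.
  have := contact_solution_bound (kappaP v) zz (lexx 0) j.
  rewrite !mulr0 -eq_le => /eqP/esym/eqP; rewrite mulf_eq0 expf_eq0.
  by rewrite (gt_eqF base_gt0) andbF [z^T _ _]mxE => /eqP.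
pose y (v : V) := invmx (contact_mx rank_row kappa v) *m const_mx 1 : 'cV[F]_d.
have contact (v : V) j : (rank_row (kappa v j) *m y v) 0 0 = 1.
  by rewrite -contact_mulE mulKVmx ?unit// mxE.
have y_bound (v : V) j := contact_solution_bound (kappaP v) (contact v) ler01 j.
have y_ge0 (v : V) j : 0 <= y v j 0.
  have := y_bound v j; rewrite mulr1 => /andP[h _].
  by rewrite -(pmulr_rge0 _ (exprn_gt0 (sval v j) base_gt0)); lra.
(* The single term at [j] is already at least [t * 2 / 3], and [t >= 4]. *)
have large (v : V) j x : t ^+ (sval v j).+1 <= rank_row x 0 j -> 1 <= (rank_row x *m y v) 0 0.
  move=> le; rewrite mxE (bigD1 j)//=.
  have : 0 <= \sum_(i < d | i != j) rank_row x 0 i * y v i 0.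
    by apply: sumr_ge0 => i _; rewrite mulr_ge0 ?rank_row_ge0.
  have := ler_wpM2r (y_ge0 v j) le; rewrite exprS -mulrA.
  have := y_bound v j; rewrite !mulr1 => /andP[h _].
  have h4 : 4 <= t by rewrite /t ler_nat; lia.
  set q := t ^+ _ * _ in h *; set q' := rank_row _ _ _ * _.
  by nra.
have feas (v : V) x : 1 <= (rank_row x *m y v) 0 0.
  case: x => [p|j].
    (* Freeness gives [j] with [rho j <= r j p]. In case of equality, injectivity of the ranks makes
       [p] the contact itself; otherwise the term at [j] suffices. *)
    have /andP[/forallP/(_ p)/existsP[j]] := svalP v.
    rewrite leq_eqVlt => /orP[/eqP e|lt] _.
      suff -> : inl p = kappa v j by rewrite contact.
      have := kappaP v j; case: (kappa v j) => [q|k] /=.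
        by rewrite e => /andP[/eqP/r_inj->].
      by move=> /andP[_ /eqP]; rewrite e; have := r_lt j p; lia.
    by apply: (large v j); rewrite mxE ler_eXn2l ?base_gt1.
  have : (sval v j <= N)%N by rewrite -ltnS.
  rewrite leq_eqVlt => /orP[e|lt].
    suff -> : inr j = kappa v j by rewrite contact.
    have := kappaP v j; case: (kappa v j) => [q|k] /=.
      by move=> /andP[/eqP]; have := r_lt j q; have := eqP e; lia.
    by move=> /andP[/eqP->].
  by apply: (large v j); rewrite mxE eqxx ler_eXn2l ?base_gt1.
have y_inj : injective y.
  have no (u v : V) j : y u = y v -> ~ (sval u j < sval v j)%N.
    (* A common [y] would have [t ^ rho_u(j) * y_j >= 2 / 3] and [t ^ rho_v(j) * y_j <= 4 / 3],
       although the second quantity is at least [t] times the first. *)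
    move=> uv lt.
    have := y_bound u j; have := y_bound v j; rewrite !mulr1 -uv => /andP[_ h1] /andP[h2 _].
    have : t ^+ (sval u j).+1 <= t ^+ (sval v j) by rewrite ler_eXn2l ?base_gt1.
    move=> /(ler_wpM2r (y_ge0 u j)); rewrite exprS -mulrA.
    have h4 : 4 <= t by rewrite /t ler_nat; lia.
    by nra.
  move=> u v uv; apply/val_inj/ffunP => j; apply/val_inj/eqP => /=.
  by case: ltngtP => // [/(no _ _ _ uv)|/(no _ _ _ (esym uv))].
have := card_simple_vertices unit contact feas y_inj j0.
by rewrite card_sig card_sum !card_ord.
Qed.

End MaximalRanks.

(** * Generators of the feasible cone *)

Section FeasibleCone.
Context {R : realType} {d : nat}.
Implicit Types (G : set 'rV[R]_d) (g : 'rV[R]_d) (x y a b t : 'rV[\bar R]_d.+1).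
Implicit Types (C K S : set 'rV[\bar R]_d.+1).

Local Open Scope classical_set_scope.
Local Open Scope ereal_scope.

Local Notation top x := (x ord0 ord0).
Local Notation co x i := (x ord0 (lift ord0 i)).

Definition below g a : Prop := forall i, (g ord0 i)%:E < co a i.

(** A description by inequalities of the cone [Wbar], with which it is identified in [WbarE]. *)
Definition feasible G : set 'rV[\bar R]_d.+1 :=
  [set x | Tmin x /\ forall g, G g -> exists i, co x i <= top x + (g ord0 i)%:E].

Definition le_row a b : Prop := forall i, co a i <= co b i.

Definition local_upper_bound G a : Prop :=
  [/\ feasible G a, top a = 0 &
      forall b, feasible G b -> top b = 0 -> le_row a b -> b = a].

Definition contact G a (j : 'I_d) : Prop :=
  co a j = +oo \/
  exists g, [/\ G g, co a j = (g ord0 j)%:E &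
                forall k, k != j -> (g ord0 k)%:E < co a k].

Definition generators G : set 'rV[\bar R]_d.+1 := Emin `|` local_upper_bound G.

Lemma row_ext x y : top x = top y -> (forall i, co x i = co y i) -> x = y.
Proof.
move=> xy0 xy; apply/rowP => j; case: (unliftP ord0 j) => [i|] ->; last exact: xy0.
exact: xy.
Qed.

Lemma le_row_anti a b : top a = top b -> le_row a b -> le_row b a -> a = b.
Proof.
by move=> ab0 ab ba; apply: row_ext => // i; apply/eqP; rewrite eq_le ab ba.
Qed.

Lemma Tmin_row x : top x != -oo -> (forall i, co x i != -oo) -> Tmin x.
Proof. by move=> x0 xi j; case: (unliftP ord0 j) => [i|] ->. Qed.

Lemma not_belowP g a : (exists i, co a i <= (g ord0 i)%:E) <-> ~ below g a.
Proof.
split=> [[i le] lt|/existsNP[i /negP]]; first by have := lt i; rewrite ltNge le.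
by rewrite -leNgt; exists i.
Qed.

Lemma feasibleP G a : Tmin a -> top a = 0 ->
  feasible G a <-> forall g, G g -> ~ below g a.
Proof.
move=> aT a0; split=> [[_ ag] g Gg|ag].
  by apply/not_belowP; have [i] := ag g Gg; rewrite a0 add0e; exists i.
split=> // g /ag/not_belowP[i le]; exists i.
by rewrite a0 add0e.
Qed.

Lemma ex_finite_min (T : choiceType) (A : set T) (P : T -> Prop) (f : T -> R) :
  finite_set A -> exists s : \bar R,
    (forall g : T, A g -> P g -> s <= (f g)%:E) /\
    (s = +oo \/ exists g : T, [/\ A g, P g & s = (f g)%:E]).
Proof.
move=> /finite_seqP[r ->]; elim: r => [|h r [s [le sE]]].
  by exists +oo; split; [move=> g|left].
have [Ph|nPh] := pselect (P h); last first.
  exists s; split=> [g|].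
    by rewrite /= inE => /predU1P[->//|] gr; apply: le.
  by case: sE => [|[g [gr Pg sg]]]; [left|right; exists g; split=> //; rewrite /= inE [X in _ || X]gr orbT].
have [sh|hs] := leP s (f h)%:E.
  exists s; split=> [g|].
    by rewrite /= inE => /predU1P[->//|] gr; apply: le.
  by case: sE => [|[g [gr Pg sg]]]; [left|right; exists g; split=> //; rewrite /= inE [X in _ || X]gr orbT].
exists (f h)%:E; split=> [g|].
  rewrite /= inE => /predU1P[->//|] gr Pg.
  by rewrite (le_trans (ltW hs))// le.
by right; exists h; split=> //; rewrite /= inE eqxx.
Qed.

(** Coordinate [j] can be raised to the least [g_j] among the points [g] strictly below [x] in all
    other coordinates, or to [+oo] if there are none. *)
Lemma ex_raise G x j : finite_set G -> feasible G x -> top x = 0 ->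
  exists x', [/\ feasible G x', top x' = 0, le_row x x',
    forall k, k != j -> co x' k = co x k & contact G x' j].
Proof.
move=> Gfin [xT xG] x0.
have [s [le sE]] := ex_finite_min
  (fun g => forall k, k != j -> (g ord0 k)%:E < co x k) (fun g => g ord0 j) Gfin.
pose x' : 'rV[\bar R]_d.+1 :=
  \row_k (if k == lift ord0 j then s else x ord0 k).
have x'0 : top x' = 0 by rewrite mxE (negPf (neq_lift _ _)).
have x'j : co x' j = s by rewrite mxE eqxx.
have x'k k : k != j -> co x' k = co x k.
  by move=> kj; rewrite mxE (inj_eq lift_inj) (negPf kj).
have xG' := (@feasibleP G x xT x0).1 (conj xT xG).
have xs : co x j <= s.
  case: sE => [->|[g [Gg gx ->]]]; first by rewrite leey.
  have /not_belowP[i] := xG' g Gg; have [->//|ij] := eqVneq i j.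
  by rewrite leNgt gx.
have xx' : le_row x x'.
  by move=> k; have [->|/x'k->//] := eqVneq k j; rewrite x'j.
have x'T : Tmin x'.
  apply: Tmin_row => [|i]; first by rewrite x'0.
  by rewrite -ltNye (lt_le_trans _ (xx' i))// ltNye.
exists x'; split=> //.
  apply/feasibleP => // g Gg; apply/not_belowP.
  have [gx|] := pselect (forall k, k != j -> (g ord0 k)%:E < co x k).
    by exists j; rewrite x'j le.
  move=> /existsNP[k] /not_implyP[kj /negP]; rewrite -leNgt => xg.
  by exists k; rewrite x'k.
case: sE => [|[g [Gg gx sg]]]; first by left; rewrite x'j.
by right; exists g; split=> // [|k kj]; rewrite ?x'j// x'k// gx.
Qed.

Lemma contact_le G x x' j : contact G x j -> le_row x x' -> co x' j = co x j ->
  contact G x' j.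
Proof.
move=> [xj|[g [Gg gj gk]]] le e; first by left; rewrite e.
by right; exists g; split=> // [|k kj]; rewrite ?e// (lt_le_trans _ (le k))// gk.
Qed.

(** Without contact at [j], that coordinate could be raised. Conversely, if [b >= a] exceeds [a] at
    [j], the contact point at [j] lies strictly below [b]. *)
Lemma local_upper_boundP G a : finite_set G ->
  local_upper_bound G a <->
  [/\ feasible G a, top a = 0 & forall j, contact G a j].
Proof.
move=> Gfin; split=> [[aG a0 mx]|[aG a0 ac]]; split=> //.
  move=> j; have [x' [x'G x'0 le _ c]] := ex_raise j Gfin aG a0.
  by rewrite -(mx x').
move=> b [bT bG] b0 ab; apply: le_row_anti => //; first by rewrite a0.
move=> j; rewrite leNgt; apply/negP => lt.
have := (@feasibleP G b bT b0).1 (conj bT bG).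
case: (ac j) => [aj|[g [Gg gj gk]]]; first by rewrite aj ltNge leey in lt.
move=> /(_ g Gg); apply => k; have [->|kj] := eqVneq k j; first by rewrite -gj.
by rewrite (lt_le_trans (gk k kj)).
Qed.

(** The coordinates are raised one after another; a contact once gained survives, since raising
    other coordinates preserves it. *)
Lemma ex_local_upper_bound G x : finite_set G -> feasible G x -> top x = 0 ->
  exists2 a, local_upper_bound G a & le_row x a.
Proof.
move=> Gfin xG x0.
have [a [aG a0 xa ac]] : exists a, [/\ feasible G a, top a = 0, le_row x a &
    forall j, j \in enum 'I_d -> contact G a j].
  elim: (enum 'I_d) => [|j s [a [aG a0 xa ac]]]; first by exists x; split=> // i.
  have [b [bG b0 ab bk bj]] := ex_raise j Gfin aG a0.
  exists b; split=> //; first by move=> i; apply: le_trans (xa i) (ab i).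
  move=> k; rewrite inE; have [->//|kj /= ks] := eqVneq k j.
  by apply: contact_le (ac k ks) ab _; exact: bk.
exists a => //; apply/local_upper_boundP => //; split=> // j.
by apply: ac; rewrite mem_enum.
Qed.

(** * Extremal generators and minimality *)

Definition tscale (s : R) x : 'rV[\bar R]_d.+1 := \row_i (s%:E + x ord0 i).

Lemma tscale0 x : tscale 0 x = x.
Proof. by apply/rowP => i; rewrite mxE add0e. Qed.

Lemma tscale_cone C s x : min_tropical_cone C -> C x -> C (tscale s x).
Proof.
move=> [_ CT Cc] Cx.
suff -> : tscale s x = min_comb s%:E +oo x x by apply: Cc.
apply/rowP => i; rewrite !mxE addye; last exact: CT Cx i.
by rewrite min_l// leey.
Qed.

Lemma infinite_row_cone C : min_tropical_cone C -> C (\row_i +oo).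
Proof.
move=> [[x Cx] CT Cc].
suff -> : (\row_i +oo : 'rV[\bar R]_d.+1) = min_comb +oo +oo x x by apply: Cc.
by apply/rowP => i; rewrite !mxE addye ?minxx//; exact: CT Cx i.
Qed.

(* The algebraic form of extremality of the ray through [t]. *)
Definition indecomposable C t : Prop :=
  (exists i, t ord0 i != +oo) /\
  forall x y la mu s, C x -> C y -> min_comb la mu x y = tscale s t ->
    (exists s', x = tscale s' t) \/ (exists s', y = tscale s' t).

(** Removing the ray of [t] from [C] leaves a cone. If it still contained [S], then [C] would not be
    the smallest cone containing [S]. *)
Lemma indecomposable_mem S C t : generates S C -> C t -> indecomposable C t ->
  exists s, S (tscale s t).
Proof.
move=> [Ccone CE] Ct [[i ti] tdec].
apply: contrapT => no.
pose K := C `&` [set x | ~ exists s, x = tscale s t].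
have SC : S `<=` C by rewrite CE; exact: sub_gen_smallest.
have [Cne CT Cc] := Ccone.
suff /(_ t) : C `<=` K.
  by move=> /(_ Ct)[_]; apply; exists 0%R; rewrite tscale0.
rewrite [X in X `<=` _]CE; apply: smallest_sub; last first.
  by move=> x Sx; split; [exact: SC|move=> [s xs]; apply: no; exists s; rewrite -xs].
split.
- exists (\row_i +oo); split; first exact: infinite_row_cone.
  by move=> [s /rowP/(_ i)]; rewrite !mxE; move: ti; case: (t ord0 i).
- by move=> x [/CT].
- move=> x y la mu [Cx xt] [Cy yt] la0 mu0; split; first exact: Cc.
  by move=> [s] /tdec[].
Qed.

Lemma tscale_top_inj s t : top (tscale s t) = 0 -> top t = 0 -> tscale s t = t.
Proof.
rewrite mxE => + t0; rewrite t0 adde0 => /eqP; rewrite eqe => /eqP->.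
by rewrite tscale0.
Qed.

Lemma feasible_cone G : (0 < d)%N -> min_tropical_cone (feasible G).
Proof.
move=> d0; split.
- exists (\row_i +oo); split=> [i|g _]; first by rewrite mxE.
  by exists (Ordinal d0); rewrite !mxE.
- by move=> x [].
- move=> x y la mu [xT xG] [yT yG] la0 mu0; split.
    by move=> i; rewrite mxE; case: leP => _; rewrite adde_eq_ninfty negb_or ?la0 ?mu0 ?xT ?yT.
  move=> g Gg; rewrite !mxE; case: (leP (la + top x)) => _.
    have [i le] := xG g Gg; exists i; rewrite !mxE ge_min; apply/orP; left.
    by rewrite -addeA leeD2l.
  have [i le] := yG g Gg; exists i; rewrite !mxE ge_min; apply/orP; right.
  by rewrite -addeA leeD2l.
Qed.

Lemma tunit_top (i : 'I_d) : top (tunit (lift ord0 i) : 'rV[\bar R]_d.+1) = +oo.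
Proof. by rewrite mxE (negPf (neq_lift _ _)). Qed.

Lemma Emin_feasible G : @Emin R d `<=` feasible G.
Proof.
move=> _ [i _ <-]; split=> [j|g _]; first by rewrite mxE; case: ifP.
by exists i; rewrite tunit_top leey.
Qed.

Lemma local_upper_bound_feasible G : local_upper_bound G `<=` feasible G.
Proof. by move=> a []. Qed.

Lemma generators_feasible G : generators G `<=` feasible G.
Proof.
by move=> a [/Emin_feasible//|]; exact: local_upper_bound_feasible.
Qed.

Lemma adde_eq_EFin (u v : \bar R) (s : R) : u + v = s%:E ->
  exists p q : R, [/\ u = p%:E, v = q%:E & s = (p + q)%R].
Proof. by case: u v => [p| |] [q| |]// [<-]; exists p, q. Qed.

Lemma tscaleE x s t : (forall i, x ord0 i = s%:E + t ord0 i) -> x = tscale s t.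
Proof. by move=> xE; apply/rowP => i; rewrite mxE. Qed.

Lemma local_upper_bound_scale G t x (s p q : R) : (0 < d)%N ->
  local_upper_bound G t -> feasible G x -> top x = q%:E ->
  s = (p + q)%R -> (forall i, s%:E + co t i <= p%:E + co x i) ->
  x = tscale q t.
Proof.
move=> d0 [tG t0 mx] xG xq spq le.
have x'E i : tscale (- q)%R x ord0 i = (- q)%:E + x ord0 i by rewrite mxE.
have e : tscale (- q)%R x = t.
  apply: mx => [||i].
  - by apply: tscale_cone => //; exact: feasible_cone.
  - by rewrite x'E xq -EFinD addNr.
  - have := le i; rewrite x'E spq.
    move: (co t i) (co x i) => [u| |] [v| |] //; rewrite ?addey ?leey ?leNye//.
    by rewrite -!EFinD !lee_fin; lra.
apply: tscaleE => i; rewrite -e x'E addeA -EFinD subrr add0e.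
by [].
Qed.

(** The vector that attains the minimum in coordinate 0 is, once normalized, feasible and above [t],
    hence [t] itself. *)
Lemma local_upper_bound_indecomposable G t : (0 < d)%N ->
  local_upper_bound G t -> indecomposable (feasible G) t.
Proof.
move=> d0 tG; have [_ t0 _] := tG; split; first by exists ord0; rewrite t0.
move=> x y la mu s xG yG e.
have eE i : Order.min (la + x ord0 i) (mu + y ord0 i) = s%:E + t ord0 i.
  by have /rowP/(_ i) := e; rewrite !mxE.
have := eE ord0; rewrite t0 adde0; case: leP => _ /adde_eq_EFin[p [q [lap xq spq]]].
- left; exists q; apply: local_upper_bound_scale d0 tG xG xq spq _ => i.
  by rewrite -eE lap ge_min lexx.
- right; exists q; apply: local_upper_bound_scale d0 tG yG xq spq _ => i.
  by rewrite -eE lap ge_min lexx orbT.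
Qed.

(** Off the finite coordinate both terms of the minimum are infinite, so the vector attaining the
    finite value is a multiple of the ray. *)
Lemma Emin_indecomposable G t : Emin t -> indecomposable (feasible G) t.
Proof.
move=> [i _ <-]; split; first by exists (lift ord0 i); rewrite mxE eqxx.
move=> x y la mu s [xT _] [yT _] e.
have eE j : Order.min (la + x ord0 j) (mu + y ord0 j) =
    s%:E + (if j == lift ord0 i then 0 else +oo).
  by have /rowP/(_ j) := e; rewrite !mxE.
have key z nu : Tmin z -> nu + co z i = s%:E ->
    (forall j, j != lift ord0 i -> nu + z ord0 j = +oo) ->
    exists s', z = tscale s' (tunit (lift ord0 i)).
  move=> zT /adde_eq_EFin[p [q [nup zq spq]]] zj; exists q.
  apply: tscaleE => j; rewrite mxE; case: eqVneq => [->|/zj].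
    by rewrite zq adde0.
  by rewrite nup; case: (z ord0 j).
have := eE (lift ord0 i); rewrite eqxx adde0.
have oth j : j != lift ord0 i -> la + x ord0 j = +oo /\ mu + y ord0 j = +oo.
  move=> ji; have := eE j; rewrite (negPf ji) addey// => h.
  by split; apply/eqP; rewrite -leye_eq -h ge_min lexx ?orbT.
case: leP => _ h.
- by left; apply: key h _ => // j /oth[].
- by right; apply: key h _ => // j /oth[].
Qed.

Lemma generators_indecomposable G t : (0 < d)%N -> generators G t ->
  indecomposable (feasible G) t.
Proof.
move=> d0 [/Emin_indecomposable//|].
exact: local_upper_bound_indecomposable.
Qed.

(** Combining with the ray of coordinate [i], with coefficient [x_i], lowers [y_i] to [x_i] and
    changes nothing else. *)
Lemma lower_cone K x y : min_tropical_cone K -> Emin `<=` K -> K y -> Tmin x ->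
  top x = top y -> le_row x y -> K x.
Proof.
move=> [Kne KT Kc] EK Ky xT xy0 xy.
have h (s : seq 'I_d) : K (\row_j
    (if unlift ord0 j is Some i then if i \in s then co x i else co y i else top y)).
  elim: s => [|i s].
    congr K : Ky; apply/row_ext => [|i]; rewrite mxE ?unlift_none ?liftK//.
  move=> Kz.
  have := Kc _ _ 0 (co x i) Kz (EK _ (imageT (fun i => tunit (lift ord0 i)) i)).
  rewrite xT => /(_ isT isT); congr K; apply/row_ext => [|k].
    by rewrite !mxE unlift_none (negPf (neq_lift _ _)) addey ?xT// add0e min_l ?leey.
  rewrite !mxE liftK inE (inj_eq lift_inj) add0e; have [->|ki] := eqVneq k i.
    by rewrite adde0 /=; case: ifP => _; rewrite ?minxx// min_r.
  by rewrite addey ?xT// min_l ?leey.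
congr K : (h (enum 'I_d)); apply: row_ext => [|i].
  by rewrite mxE unlift_none.
by rewrite mxE liftK mem_enum.
Qed.

Lemma generators_generate G K : finite_set G -> min_tropical_cone K ->
  generators G `<=` K -> feasible G `<=` K.
Proof.
move=> Gfin Kcone GK x [xT xG].
have EK : @Emin R d `<=` K by move=> e Ee; apply: GK; left.
case x0 : (top x) => [r| |]; last by have := xT ord0; rewrite x0.
- have x'G : feasible G (tscale (- r)%R x).
    split=> [i|g Gg]; first by rewrite mxE adde_eq_ninfty negb_or xT.
    have [i le] := xG g Gg; exists i; rewrite !mxE -addeA.
    by rewrite leeD2l.
  have x'0 : top (tscale (- r)%R x) = 0 by rewrite mxE x0 -EFinD addNr.
  have [a aG xa] := ex_local_upper_bound Gfin x'G x'0.
  have Ka : K a by apply: GK; right.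
  have [_ a0 _] := aG.
  have Kx' : K (tscale (- r)%R x).
    by apply: lower_cone Kcone EK Ka _ _ xa; [case: x'G|rewrite a0].
  suff -> : x = tscale r (tscale (- r)%R x) by exact: tscale_cone.
  by apply: tscaleE => i; rewrite mxE addeA -EFinD subrr add0e.
(* A vector with infinite 0th coordinate is obtained by lowering the all-infinite vector. *)
- apply: (lower_cone Kcone EK (infinite_row_cone Kcone)) => // [|i].
    by rewrite mxE.
  by rewrite mxE leey.
Qed.

Lemma generates_generators G : (0 < d)%N -> finite_set G ->
  generates (generators G) (feasible G).
Proof.
move=> d0 Gfin; have fc := feasible_cone G d0; split=> //; apply/seteqP; split.
  by move=> x xG K [Kc GK]; exact: generators_generate Kc GK _ xG.
apply: smallest_sub => //; exact: generators_feasible.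
Qed.

Lemma generators_tscale_inj G s t : generators G t -> generators G (tscale s t) ->
  tscale s t = t.
Proof.
move=> [[i _ <-]|[_ t0 _]].
  move=> [[k _ e]|[_ + _]]; last first.
    by rewrite mxE tunit_top addey.
  have /rowP/(_ (lift ord0 i)) := e; rewrite !mxE eqxx adde0.
  by case: ifP => // _ [<-]; rewrite tscale0.
move=> [[k _ e]|[_ e _]]; last exact: tscale_top_inj.
by have /rowP/(_ ord0) := e; rewrite tunit_top mxE t0 adde0.
Qed.

Lemma minimal_generators G : (0 < d)%N -> finite_set G ->
  minimal_generating_set (generators G) (feasible G).
Proof.
move=> d0 Gfin; split; first exact: generates_generators.
move=> S SG gS; apply/seteqP; split=> // t tG.
have [s St] := indecomposable_mem gS (generators_feasible tG)
  (generators_indecomposable d0 tG).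
by rewrite -(generators_tscale_inj tG (SG _ St)).
Qed.

Lemma extremal_generator_top G a : (0 < d)%N -> finite_set G ->
  top a = 0 -> extremal_generator (feasible G) a <-> local_upper_bound G a.
Proof.
move=> d0 Gfin a0; split=> [[S [gS mS] Sa]|aG]; last first.
  by exists (generators G); [exact: minimal_generators|right].
(* Indecomposability puts a multiple of every generator in [S], so [S'] still generates the cone and
   equals [S] by minimality. *)
pose S' := S `&` [set b | exists s, exists2 t, generators G t & b = tscale s t].
have : S' a.
  rewrite (mS S')//; first by move=> ? [].
  have [fc fE] := gS; split=> //; apply/seteqP; split.
    move=> x xG K [Kc S'K]; apply: (generators_generate Gfin Kc) xG => t tG.
    have [s St] := indecomposable_mem gS (generators_feasible tG)
      (generators_indecomposable d0 tG).
    have S't : S' (tscale s t) by split=> //; exists s, t.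
    suff -> : t = tscale (- s)%R (tscale s t) by apply: tscale_cone => //; exact: S'K.
    by apply: tscaleE => i; rewrite mxE addeA -EFinD addNr add0e.
  apply: smallest_sub => // x [Sx _].
  by rewrite fE; exact: sub_gen_smallest.
move=> [_ [s [t [[i _ <-]|tG] at_]]].
  by move: a0; rewrite at_ mxE tunit_top addey.
have [_ t0 _] := tG.
by move: a0; rewrite at_ => /tscale_top_inj->.
Qed.

End FeasibleCone.

(** * The closure of W(G) *)

Section RowNeighbourhoods.
Local Open Scope classical_set_scope.

Lemma nbhs_row (T : topologicalType) m (x : 'rV[T]_m) (P : 'I_m -> set T) :
  (forall j, nbhs (x ord0 j) (P j)) -> nbhs x [set y | forall j, P j (y ord0 j)].
Proof.
move=> xP; exists (fun=> P) => [i j|y yP j]; last exact: yP.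
by rewrite ord1; exact: xP.
Qed.

Lemma nbhs_rowP (T : topologicalType) m (x : 'rV[T]_m) (B : set 'rV[T]_m) :
  nbhs x B -> exists P : 'I_m -> set T,
    (forall j, nbhs (x ord0 j) (P j)) /\ forall y : 'rV[T]_m, (forall j, P j (y ord0 j)) -> B y.
Proof.
move=> [P xP PB]; exists (P ord0); split=> // y yP; apply: PB => i j.
by rewrite ord1.
Qed.

End RowNeighbourhoods.

Section ClosedWset.
Context {R : realType} {d : nat}.
Implicit Types (G : set 'rV[R]_d) (g : 'rV[R]_d).

Local Open Scope classical_set_scope.

Local Notation top x := (x ord0 ord0).
Local Notation co x i := (x ord0 (lift ord0 i)).

Lemma point_co g i : co (Defs.point g) i = g ord0 i.
Proof. by rewrite mxE liftK. Qed.

Lemma MsetP G (x : 'rV[R]_d.+1) : Mset (tmax_point @` G) x <->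
  exists2 g, G g & forall i, top x + g ord0 i <= co x i.
Proof.
split=> [[_ [g Gg <-] h]|[g Gg h]].
  exists g => // i; have := h (lift ord0 i) isT.
  by rewrite !mxE unlift_none liftK -!EFinB lee_fin => /(_ isT); lra.
exists (tmax_point g); first by exists g.
move=> j; case: (unliftP ord0 j) => [i|] ->; last by rewrite eqxx.
by move=> _ _; rewrite !mxE unlift_none liftK -!EFinB lee_fin; have := h i; lra.
Qed.

(** If [x] violates the condition of [g], some real [c > x_0] still satisfies [c + g_i < x_i] for
    all [i]. The open box [y_0 < c], [y_i > c + g_i] around [x] has all its real points in
    [Mset]. *)
Lemma closure_Wset_feasible G : (0 < d)%N -> Wbar (tmax_point @` G) `<=` feasible G.
Proof.
move=> d0 x [xW xT]; split=> // g Gg; apply: contrapT => /forallNP no.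
have gt i : (top x + (g ord0 i)%:E < co x i)%E by rewrite ltNge; apply/negP/no.
have [r x0] : exists r, top x = r%:E.
  have := gt (Ordinal d0); have := xT ord0.
  by case: (top x) => [r| |]//; [exists r|rewrite addye// ltNge leey].
have [c rc cP] : exists2 c, r < c & forall i, ((c + g ord0 i)%:E < co x i)%E.
  have ci i : exists c, r < c /\ ((c + g ord0 i)%:E < co x i)%E.
    have := gt i; rewrite x0; have := xT (lift ord0 i).
    case: (co x i) => [v| |]// _ h; last by exists (r + 1); rewrite ltry; split=> //; lra.
    exists ((r + (v - g ord0 i)) / 2); move: h; rewrite -EFinD !lte_fin => h.
    by split; lra.
  have [c cP] := choice ci.
  have [s [le [s_oo|[i [_ _ sE]]]]] :=
    ex_finite_min (fun=> True) c (@finite_finset _ [set: 'I_d]).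
    by have := le (Ordinal d0) I I; rewrite s_oo.
  exists (c i) => [|k]; first exact: (cP i).1.
  have := le k I I; rewrite sE lee_fin => ck.
  by rewrite (le_lt_trans _ (cP k).2)// lee_fin; lra.
pose P (j : 'I_d.+1) : set (\bar R) :=
  if unlift ord0 j is Some i then [set y | ((c + g ord0 i)%:E < y)%E]
  else [set y | (y < c%:E)%E].
have [|_ [[w wW <-] wP]] := xW [set y | forall j, P j (y ord0 j)].
  apply: nbhs_row => j; rewrite /P; case: (unliftP ord0 j) => [i|] ->.
    by apply: open_nbhs_nbhs; split; [exact: open_ereal_gt_ereal|exact: cP].
  apply: open_nbhs_nbhs; split; first exact: open_ereal_lt_ereal.
  by rewrite /= x0 lte_fin.
(* The same box among real vectors serves for the inner closure, the one defining [Wset]. *)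
pose Q (j : 'I_d.+1) : set R :=
  if unlift ord0 j is Some i then [set y | c + g ord0 i < y] else [set y | y < c].
have [|w' [w'M w'Q]] := wW [set y | forall j, Q j (y ord0 j)].
  apply: nbhs_row => j; have := wP j; rewrite /P /Q mxE.
  case: (unliftP ord0 j) => [i|] -> /=; rewrite lte_fin => h.
    by apply: open_nbhs_nbhs; split; [exact: open_gt|].
  by apply: open_nbhs_nbhs; split; [exact: open_lt|].
apply: w'M; apply/MsetP; exists g => // i.
have := w'Q (lift ord0 i); have := w'Q ord0; rewrite /Q liftK unlift_none /=.
by lra.
Qed.

(** Truncating the other coordinates at a large [N] and replacing the 0th one by a suitable real [e]
    makes all inequalities strict, so real vectors outside [Mset] approximate [x]. *)
Lemma feasible_closure_Wset G : (0 < d)%N -> finite_set G ->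
  feasible G `<=` Wbar (tmax_point @` G).
Proof.
move=> d0 Gfin x [xT xG]; split=> // B /nbhs_rowP[P [xP PB]].
have Mj j : exists M, forall N, M <= N -> P j (Order.min (x ord0 j) N%:E).
  have := xP j; have := xT j; case: (x ord0 j) => [r| |]// _.
    by move=> /nbhs_singleton Pr; exists r => N rN; rewrite min_l.
  move=> [M [_ MP]]; exists (M + 1) => N MN; rewrite min_r ?leey//.
  by apply: MP; rewrite lte_fin; lra.
have [M MP] := choice Mj.
pose N := \big[Order.max/0]_j M j.
have NP j : P j (Order.min (x ord0 j) N%:E) by apply: MP; exact: le_bigmax.
pose w0 i := fine (Order.min (co x i) N%:E).
have w0E i : (w0 i)%:E = Order.min (co x i) N%:E.
  by rewrite fineK//; have := xT (lift ord0 i); case: (co x i) => [r| |]//;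
    rewrite -?EFin_min// min_r// leey.
have [e Pe eP] : exists2 e : R, P ord0 e%:E &
    forall g, G g -> exists i, w0 i < e + g ord0 i.
  have := xP ord0; have := xT ord0; case x0 : (top x) => [r| |]// _.
    move=> rP; have /nbhs_ballP[e /= e0 eP] : nbhs r (fun s : R => P ord0 s%:E) := rP.
    exists (r + e / 2).
      by apply: eP; rewrite -ball_normE /= opprD addrA subrr add0r normrN gtr0_norm; lra.
    move=> g Gg; have [i le] := xG g Gg; exists i.
    rewrite -lte_fin w0E gt_min; apply/orP; left; apply: le_lt_trans le _.
    by rewrite x0 -EFinD lte_fin; lra.
  (* For infinite [x_0], a single coordinate [i0] serves all points once [e] exceeds [N - b], where
     [b] bounds their entries there from below. *)
  move=> [m [_ mP]]; pose i0 := Ordinal d0.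
  have [s [le sE]] := ex_finite_min (fun=> True) (fun g : 'rV[R]_d => g ord0 i0) Gfin.
  have [b bP] : exists b, forall g, G g -> b <= g ord0 i0.
    case: sE => [s_oo|[h [_ _ sE]]].
      by exists 0 => g Gg; have := le g Gg I; rewrite s_oo.
    by exists (h ord0 i0) => g Gg; rewrite -lee_fin -sE le.
  exists (Order.max (m + 1) (N - b + 1)).
    by apply: mP; rewrite lte_fin lt_max; apply/orP; left; lra.
  move=> g Gg; exists i0; have := bP g Gg.
  have : w0 i0 <= N by rewrite -lee_fin w0E ge_min lexx orbT.
  have : N - b + 1 <= Order.max (m + 1) (N - b + 1) by rewrite le_max lexx orbT.
  by lra.
pose w : 'rV[R]_d.+1 := \row_j (if unlift ord0 j is Some i then w0 i else e).
exists (real_to_ext w); split.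
  exists w => //; apply: subset_closure => /MsetP[g Gg].
  have [i lt] := eP g Gg => /(_ i).
  by rewrite !mxE unlift_none liftK; lra.
apply: PB => j; rewrite !mxE; case: (unliftP ord0 j) => [i|] -> //.
by rewrite w0E.
Qed.

Lemma WbarE G : (0 < d)%N -> finite_set G -> Wbar (tmax_point @` G) = feasible G.
Proof.
move=> d0 Gfin; apply/seteqP; split; first exact: closure_Wset_feasible.
exact: feasible_closure_Wset.
Qed.

End ClosedWset.

(** * The algorithm *)

Section NewExtremals.
Context {R : realType} {d : nat}.
Implicit Types (G : set 'rV[R]_d) (g h : 'rV[R]_d) (a b c : 'rV[\bar R]_d.+1).

Local Open Scope classical_set_scope.
Local Open Scope ereal_scope.

Local Notation top x := (x ord0 ord0).
Local Notation co x i := (x ord0 (lift ord0 i)).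

Lemma min_diffP a h : (0 < d)%N ->
  min_diff a (Defs.point h) <= top a <-> exists i, co a i <= top a + (h ord0 i)%:E.
Proof.
move=> d0; split=> [/bigmin_leP[|[i _]]|[i le]].
- by rewrite leye_eq => /eqP->; exists (Ordinal d0); rewrite leey.
- by rewrite point_co leeBlDr// => le; exists i.
- by apply: (@bigmin_inf _ _ _ _ i) => //; rewrite point_co leeBlDr.
Qed.

Lemma feasibleU1 G h a : feasible (G `|` [set h]) a <->
  feasible G a /\ exists i, co a i <= top a + (h ord0 i)%:E.
Proof.
split=> [[aT aG]|[[aT aG] ah]].
  by split; [split=> // g Gg|]; apply: aG; [left|right].
by split=> // g [/aG|->].
Qed.

Lemma local_upper_boundU1 G h a : local_upper_bound G a ->
  (exists i, co a i <= top a + (h ord0 i)%:E) -> local_upper_bound (G `|` [set h]) a.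
Proof.
move=> [aG a0 mx] ah; split=> //; first exact/feasibleU1.
by move=> b /feasibleU1[bG _]; exact: mx.
Qed.

Lemma Emin_Age G h : (0 < d)%N -> Emin `<=` Age (generators G) (Defs.point h).
Proof.
move=> d0 _ [i _ <-]; split; first by left; exists i.
by rewrite tunit_top leey.
Qed.

Lemma min_diff_tunit h (j : 'I_d) :
  min_diff (tunit (lift ord0 j)) (Defs.point h) = (- h ord0 j)%:E.
Proof.
apply/eqP; rewrite eq_le; apply/andP; split.
  by apply: (@bigmin_inf _ _ _ _ j) => //; rewrite mxE eqxx point_co sub0e.
apply: le_bigmin => [|i _]; first by rewrite leey.
rewrite mxE point_co (inj_eq lift_inj); case: eqVneq => [->|_].
  by rewrite sub0e.
by rewrite leey.
Qed.

(* A new local upper bound is an old one [c] lowered to [h] in one coordinate,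
   hence a combination of [c] with one of the rays in [Emin]. *)
Lemma local_upper_boundU1_comb G h a : finite_set G ->
  local_upper_bound (G `|` [set h]) a -> ~ local_upper_bound G a ->
  exists j c, [/\ local_upper_bound G c, below h c &
    a = min_comb (h ord0 j)%:E 0 (tunit (lift ord0 j)) c].
Proof.
move=> Gfin [/feasibleU1[aG [j aj]] a0 mx] naG.
move: aj; rewrite a0 add0e => aj.
have [c cG ac] := ex_local_upper_bound Gfin aG a0.
have [[cT cG'] c0 _] := cG.
have hc : below h c.
  apply: contrapT => /not_belowP[i ci]; apply: naG.
  rewrite -(mx c)//; apply/feasibleU1; split=> //.
  by exists i; rewrite c0 add0e.
exists j, c; split=> //; set y := min_comb _ _ _ _.
have y0 : top y = 0 by rewrite !mxE (negPf (neq_lift _ _)) addey// add0e c0 min_r// leey.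
have yj : co y j = (h ord0 j)%:E.
  by rewrite !mxE eqxx adde0 add0e min_l// ltW.
have yi i : i != j -> co y i = co c i.
  by move=> ij; rewrite !mxE (inj_eq lift_inj) (negPf ij) addey// add0e min_r// leey.
have yc i : co y i <= co c i.
  by have [->|/yi->//] := eqVneq i j; rewrite yj ltW.
apply/esym/mx => //; last first.
  by move=> i; have [->|/yi->] := eqVneq i j; [rewrite yj|exact: ac].
apply/feasibleU1; split; last by exists j; rewrite yj y0 add0e.
split.
  apply: Tmin_row => [|i]; first by rewrite y0.
  by have [->|/yi->] := eqVneq i j; [rewrite yj|exact: cT].
move=> g Gg; have [i le] := cG' g Gg; exists i.
by rewrite y0 -c0 (le_trans (yc i)).
Qed.

(** This keeps [A] equal to the generators throughout the loop. Pairs with first member in [Emin]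
    already produce every new local upper bound; other pairs add nothing wrong because extremality
    is tested. *)
Lemma new_extremalsE G h : (0 < d)%N -> finite_set G ->
  new_extremals (tmax_point @` G) (generators G) (Defs.point h) =
  generators (G `|` [set h]).
Proof.
move=> d0 Gfin.
have GE : tmax_point @` G `|` [set real_to_ext (Defs.point h)] =
    tmax_point @` (G `|` [set h]) by rewrite image_setU image_set1.
have Gfin' : finite_set (G `|` [set h]) by rewrite finite_setU.
have extE a : top a = 0 -> extremal_generator
    (Wbar (tmax_point @` G `|` [set real_to_ext (Defs.point h)])) a <->
    local_upper_bound (G `|` [set h]) a.
  by move=> a0; rewrite GE WbarE//; exact: extremal_generator_top.
apply/seteqP; split=> a.
  move=> [[[aE|aG] /min_diffP-/(_ d0) ah]|]; first by left.
    by right; exact: local_upper_boundU1.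
  move=> [b [c /= [[bA bh] [cA nch] ext ->]]]; right.
  have cG : local_upper_bound G c.
    by case: cA => // /(Emin_Age G h d0)/nch.
  have [_ c0 _] := cG.
  move: ext; set e := min_comb _ _ _ _ => ext.
  (* The condition defining [Age] makes the 0th coordinate of the scaled [b] nonnegative, so that of
     [c] prevails and [dehomogenize] changes nothing. *)
  have e0 : top e = 0.
    rewrite !mxE c0 add0e min_r//.
    case: bA bh => [[i _ <-] _|[_ -> _]]; last by rewrite adde0 oppe_ge0.
    by rewrite min_diff_tunit tunit_top addey ?leey.
  suff -> : dehomogenize e = e by apply/extE.
  apply: row_ext => [|i]; first by rewrite mxE eqxx e0.
  by rewrite mxE eq_sym (negPf (neq_lift _ _)) e0 sube0.
move=> [/(Emin_Age G h d0)|aG]; first by left.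
have [/feasibleU1[_ ah] a0 _] := aG.
have [aG'|naG] := pselect (local_upper_bound G a).
  by left; split; [right|apply/min_diffP].
have [j [c [cG hc aE]]] := local_upper_boundU1_comb Gfin aG naG.
right; exists (tunit (lift ord0 j)), c => /=; rewrite min_diff_tunit EFinN oppeK -aE.
split.
- by apply: Emin_Age => //; exists j.
- split; first by right.
  move=> [_ /min_diffP-/(_ d0)]; have [_ c0 _] := cG; rewrite c0.
  by move=> [i]; rewrite add0e leNgt hc.
- exact/extE.
- apply: row_ext => [|i]; first by rewrite mxE eqxx a0.
  by rewrite mxE eq_sym (negPf (neq_lift _ _)) a0 sube0.
Qed.

End NewExtremals.

(** * Runs of the loop: invariant, termination and exact count *)

Section Run.
Context {R : realType} {d : nat}.
Context (pick : set 'rV[R]_d -> state R d -> 'rV[\bar R]_d.+1).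
Context (oracle : set 'rV[R]_d -> 'rV[\bar R]_d.+1 -> option 'rV[R]_d).
Context (d0 : (0 < d)%N) (hpick : is_pick_rule pick).
Context (horacle : is_NextNonDominated oracle).

Local Open Scope classical_set_scope.

Local Notation top x := (x ord0 ord0).
Local Notation co x i := (x ord0 (lift ord0 i)).

Lemma oracle_answerP (Z : set 'rV[R]_d) a z : oracle_answer Z a z <-> nondominated Z z /\ below z a.
Proof.
split=> -[Zz za]; split=> // i.
by have [->|] := eqVneq (co a i) +oo%E; [rewrite ltry|exact: za].
Qed.

(* [sO] lists the local upper bounds already certified by the answer [None], so
   the number of oracle calls made so far is [size sG + size sO]. *)
Definition run_invariant (Z : set 'rV[R]_d) (s : state R d)
    (sG : seq 'rV[R]_d) (sO : seq 'rV[\bar R]_d.+1) : Prop :=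
  [/\ stG s = [set` sG], stA s = generators [set` sG] &
      stOmega s = Emin `|` [set` sO]] /\
  [/\ uniq sG, uniq sO, [set` sG] `<=` nondominated Z &
      forall a, a \in sO -> local_upper_bound [set` sG] a /\
        forall z, nondominated Z z -> ~ below z a].

Lemma Emin_not_local_upper_bound (G : set 'rV[R]_d) a : @Emin R d a -> ~ local_upper_bound G a.
Proof. by move=> [i _ <-] [_]; rewrite tunit_top. Qed.

Lemma generators0 : generators (set0 : set 'rV[R]_d) = Emin `|` [set tunit ord0].
Proof.
rewrite /generators; congr (_ `|` _); apply/seteqP; split=> a.
  move=> [aG a0 mx] /=; apply/esym/mx.
  - by split=> // i; rewrite mxE; case: ifP.
  - by rewrite mxE eqxx.
  - by move=> i; rewrite mxE eq_sym (negPf (neq_lift _ _)) leey.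
move=> ->; split; first by split=> // i; rewrite mxE; case: ifP.
  by rewrite mxE eqxx.
move=> b _ b0 le; apply: row_ext => [|i]; first by rewrite b0 mxE eqxx.
apply/eqP; have := le i.
by rewrite mxE eq_sym (negPf (neq_lift _ _)) leye_eq.
Qed.

Lemma run_invariant_init Z : run_invariant Z init_state [::] [::].
Proof.
have e0 (T : eqType) : [set` [::]] = set0 :> set T by apply/seteqP; split.
by split; split=> //; rewrite e0 ?generators0 ?setU0.
Qed.

Lemma run_invariant_step Z s sG sO : run_invariant Z s sG sO ->
  stA s <> stOmega s -> exists sG' sO',
    run_invariant Z (nda_step pick oracle Z s) sG' sO' /\
    (size sG' + size sO' = (size sG + size sO).+1)%N.
Proof.
move=> [[GE AE OE] [uG uO GZ OP]] neq.
have OA : stOmega s `<=` stA s.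
  by rewrite OE AE => a [?|/OP[]]; [left|right].
have ne : stA s `\` stOmega s !=set0.
  apply/set0P/eqP; rewrite setD_eq0 => AO; apply: neq; apply/seteqP; split=> //.
have [] := hpick Z ne; rewrite /nda_step; set a := pick Z s => aA aO.
have aG : local_upper_bound [set` sG] a.
  by move: aA; rewrite AE => -[aE|//]; case: aO; rewrite OE; left.
have [[aT aG'] a0 _] := aG.
have := horacle Z aT a0; case: (oracle Z a) => [g /oracle_answerP[Zg ga]|none].
  have gG : g \notin sG.
    by apply/negP => gG; have /(feasibleP _ aT a0)-/(_ g gG) := conj aT aG'.
  have GE' : [set` g :: sG] = [set` sG] `|` [set g].
    apply/seteqP; split=> x /=; rewrite inE.
      by move=> /predU1P[->|]; [right|left].
    by move=> [->|->]; rewrite ?eqxx ?orbT.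
  exists (g :: sG), sO; split=> //; split; split=> //=.
  - by rewrite GE GE'.
  - by rewrite GE' AE GE new_extremalsE//; exact: finite_seqP.
  - by rewrite gG.
  - by move=> x /=; rewrite inE => /predU1P[->//|]; exact: GZ.
  (* The new point is nondominated, hence not below a certified bound, which therefore survives its
     insertion. *)
  - move=> b bO; have [bG bZ] := OP b bO; split=> //.
    rewrite GE'; apply: local_upper_boundU1 => //; have [_ b0 _] := bG.
    by have /not_belowP[i le] := bZ g Zg; exists i; rewrite b0 add0e.
exists sG, (a :: sO); split; last by rewrite addnS.
split; split=> //=.
- rewrite OE -setUA; congr (_ `|` _); apply/seteqP; split=> x /=; rewrite inE.
    by move=> [->|->]; rewrite ?eqxx ?orbT.
  by move=> /predU1P[->|]; [right|left].
- by rewrite uO andbT; apply/negP => a_sO; apply: aO; rewrite OE; right.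
- move=> b; rewrite inE => /predU1P[->|/OP//]; split=> // z Zz za.
  by apply: none; exists z; apply/oracle_answerP.
Qed.

Lemma run_invariant_iter Z j :
  (forall i, (i < j)%N -> let s := iter i (nda_step pick oracle Z) init_state in
     stA s <> stOmega s) ->
  exists sG sO, run_invariant Z (iter j (nda_step pick oracle Z) init_state) sG sO /\
    (size sG + size sO = j)%N.
Proof.
elim: j => [_|j IH lt]; first by exists [::], [::]; split=> //; exact: run_invariant_init.
have [|sG [sO [inv sz]]] := IH; first by move=> i ij; apply: lt; exact: ltnW.
by have [sG' [sO' [inv' sz']]] := run_invariant_step inv (lt j (ltnSn j));
  exists sG', sO'; rewrite sz' sz.
Qed.

Lemma nondominated_incomparable (Z : set 'rV[R]_d) g z : nondominated Z g ->
  nondominated Z z -> g != z -> exists i, z ord0 i < g ord0 i.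
Proof.
move=> [Zg _] [_ zmin] gz; apply: contrapT => /forallNP le.
have {}le i : g ord0 i <= z ord0 i by rewrite leNgt; apply/negP/le.
apply: zmin; exists g; split=> //; apply: contrapT => /forallNP nlt.
move/eqP: gz; apply; apply/rowP => i; apply/eqP; rewrite eq_le le leNgt.
exact/negP/nlt.
Qed.

Lemma ex_local_upper_bound_above (Z G : set 'rV[R]_d) z : finite_set G ->
  G `<=` nondominated Z -> nondominated Z z -> ~ G z ->
  exists2 a, local_upper_bound G a & below z a.
Proof.
move=> Gfin GZ Zz Gz.
(* The coordinate [x_i] is the least [g_i] exceeding [z_i]. Every [g] in [G] exceeds [z] somewhere,
   so none is below [x], while [z] is. *)
have [s sP] := choice (fun i => ex_finite_min
  (fun g : 'rV[R]_d => z ord0 i < g ord0 i) (fun g => g ord0 i) Gfin).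
pose x : 'rV[\bar R]_d.+1 := \row_j (if unlift ord0 j is Some i then s i else 0%E).
have x0 : top x = 0%E by rewrite mxE unlift_none.
have xi i : co x i = s i by rewrite mxE liftK.
have zx : below z x.
  move=> i; rewrite xi; case: (sP i) => _ [->|[g [_ zg ->]]]; first exact: ltry.
  by rewrite lte_fin.
have xT : Tmin x.
  apply: Tmin_row => [|i]; first by rewrite x0.
  by rewrite -ltNye (lt_trans _ (zx i))// ltNyr.
have xG : feasible G x.
  apply/feasibleP => // g Gg; apply/not_belowP.
  have gz : g != z by apply/eqP => gz; apply: Gz; rewrite -gz.
  have [i lt] := nondominated_incomparable (GZ g Gg) Zz gz.
  by exists i; rewrite xi; apply: (sP i).1.
have [a aG xa] := ex_local_upper_bound Gfin xG x0.
by exists a => // i; apply: lt_le_trans (zx i) (xa i).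
Qed.

Lemma ex_enum_card (T : choiceType) (A : set T) n : (A #= `I_n)%card ->
  exists s : seq T, [/\ uniq s, size s = n & A = [set` s]].
Proof.
move=> An; have Afin : finite_set A by exists n.
exists (enum_fset (fset_set A)); split.
- exact: fset_uniq.
- exact: card_fset_set.
- by rewrite -[LHS]fset_setK.
Qed.

(** At termination every local upper bound is certified. A missing nondominated point would lie
    below one of them, so [G] is complete. *)
Lemma scalarizationsP Z n k : discrete_with Z n ->
  scalarizations pick oracle Z k ->
  exists sO, [/\ uniq sO, [set` sO] = local_upper_bound (nondominated Z) &
                 k = (n + size sO)%N].
Proof.
move=> [_ /ex_enum_card[sN [uN szN NE]]] [lt eq].
have [sG [sO [[[GE AE OE] [uG uO GZ OP]] sz]]] := run_invariant_iter lt.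
have AO : generators [set` sG] = Emin `|` [set` sO] by rewrite -AE -OE.
have GN : [set` sG] = nondominated Z.
  apply/seteqP; split=> // z Zz; apply: contrapT => zG.
  have [a aG za] := ex_local_upper_bound_above (finite_seq sG) GZ Zz zG.
  have : generators [set` sG] a by right.
  rewrite AO => -[/Emin_not_local_upper_bound/(_ aG)//|/OP[_ /(_ z Zz)]].
  by apply.
exists sO; split=> //.
  apply/seteqP; split=> [a /OP[]|a]; rewrite -GN// => aG.
  have : generators [set` sG] a by right.
  by rewrite AO => -[/Emin_not_local_upper_bound/(_ aG)|].
rewrite -sz -szN; congr (_ + _)%N; apply/eqP.
rewrite -uniq_size_uniq// => x.
by have := congr1 (fun A : set _ => A x) (etrans GN NE) => /= /propeqP[h1 h2];
  apply/idP/idP.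
Qed.

Lemma ex_scalarizations Z n K : discrete_with Z n ->
  (forall (sG : seq 'rV[R]_d) (sO : seq 'rV[\bar R]_d.+1), (size sG <= n)%N ->
     uniq sO -> [set` sO] `<=` local_upper_bound [set` sG] -> (size sO <= K)%N) ->
  exists k, scalarizations pick oracle Z k.
Proof.
move=> [_ /ex_enum_card[sN [uN szN NE]]] bound.
pose st j := iter j (nda_step pick oracle Z) init_state.
have [j jP] : exists j, `[< stA (st j) = stOmega (st j) >].
  apply: contrapT => /forallNP no.
  (* Every pass enlarges [sG] or [sO], whose sizes are at most [n] and [K]. *)
  have [|sG [sO [[_ [uG uO GZ OP]] sz]]] := @run_invariant_iter Z (n + K).+1.
    by move=> i _ /= e; apply: (no i); apply/asboolP.
  have szG : (size sG <= n)%N.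
    rewrite -szN; apply: uniq_leq_size => // x /GZ.
    by rewrite NE.
  have := bound sG sO szG uO (fun a aO => (OP a aO).1).
  by lia.
have ex : exists j, `[< stA (st j) = stOmega (st j) >] by exists j.
case: (ex_minnP ex) => k /asboolP kP mn; exists k; split=> // i ik.
by move=> /asboolP/mn; lia.
Qed.

End Run.

(** * Counting local upper bounds *)

Section Ranks.
Context {R : realType} {N : nat}.

(* Ties are broken by the indices of the points. *)
Definition rank (f : 'I_N -> R) (p : 'I_N) : nat :=
  #|[pred q | (f q < f p) || ((f q == f p) && (q < p)%N)]|.

Lemma rank_ltN f p : (rank f p < N)%N.
Proof.
rewrite -[X in (_ < X)%N]card_ord; apply: proper_card; apply/fintype.properP.
by split; [exact/fintype.subsetP|exists p => //; rewrite inE ltxx ltnn andbF].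
Qed.

Lemma rank_lt (f : 'I_N -> R) (p q : 'I_N) : f p < f q \/ f p = f q /\ (p < q)%N -> (rank f p < rank f q)%N.
Proof.
move=> pq; apply: proper_card; apply/fintype.properP; split.
  apply/fintype.subsetP => x; rewrite !inE => /orP[xp|/andP[/eqP xp ltxp]].
    by apply/orP; left; case: pq => [|[<-//]]; exact: lt_trans.
  case: pq => [pq|[pq ltpq]]; first by rewrite xp pq.
  by rewrite xp pq eqxx (ltn_trans ltxp) ?orbT.
exists p; rewrite !inE ?ltxx ?ltnn ?andbF//.
by case: pq => [->//|[-> ->]]; rewrite eqxx orbT.
Qed.

Lemma rank_inj f : injective (rank f).
Proof.
move=> p q e; apply/val_inj/eqP; apply: contrapT => /negP; rewrite neq_ltn => pq.
have [lt|lt|eq] := ltgtP (f p) (f q).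
- by have := @rank_lt f p q (or_introl lt); rewrite e ltnn.
- by have := @rank_lt f q p (or_introl lt); rewrite e ltnn.
- case/orP: pq => lt.
    by have := @rank_lt f p q (or_intror (conj eq lt)); rewrite e ltnn.
  by have := @rank_lt f q p (or_intror (conj (esym eq) lt)); rewrite e ltnn.
Qed.

(** Counting the values below [u] turns a threshold into a rank that compares with all points
    exactly as [u] does, however ties are broken. *)
Lemma leq_rank f p (u : \bar R) :
  (#|[pred q | ((f q)%:E < u)%E]| <= rank f p)%N = (u <= (f p)%:E)%E.
Proof.
have [up|pu] := leP u (f p)%:E.
  apply: subset_leq_card; apply/fintype.subsetP => q; rewrite !inE => qu.
  by rewrite -lte_fin (lt_le_trans qu).
apply/negbTE; rewrite -ltnNge; apply: proper_card; apply/fintype.properP; split.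
  apply/fintype.subsetP => q; rewrite !inE => /orP[qp|/andP[/eqP-> _]//].
  by rewrite (lt_trans _ pu)// lte_fin.
by exists p; rewrite !inE// ltxx ltnn andbF.
Qed.

End Ranks.

Section CountLocalUpperBounds.
Context {R : realType} {d : nat}.

Local Open Scope classical_set_scope.

Local Notation co x i := (x ord0 (lift ord0 i)).

(* Breaking ties sends every local upper bound to a maximal rank vector. *)
Lemma card_local_upper_bounds (sG : seq 'rV[R]_d) (sO : seq 'rV[\bar R]_d.+1) :
  (0 < d)%N -> uniq sO -> [set` sO] `<=` local_upper_bound [set` sG] ->
  (size sO <= 2 * 2 ^ d * (size sG + d) ^ (d %/ 2))%N.
Proof.
move=> d0 uO sub; set N := size sG.
pose f (j : 'I_d) (p : 'I_N) : R := (nth 0 sG p) ord0 j.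
pose r j := rank (f j).
have r_lt j p : (r j p < N)%N := rank_ltN (f j) p.
have r_inj j : injective (r j) := @rank_inj _ _ (f j).
(* [phi] translates ranks back into coordinates; rank [N] gives an empty minimum, that is [+oo]. *)
pose phi (rho : {ffun 'I_d -> 'I_N.+1}) : 'rV[\bar R]_d.+1 :=
  \row_k (if unlift ord0 k is Some j then
    \big[Order.min/+oo%E]_(p | (rho j <= r j p)%N) (f j p)%:E else 0%E).
apply: leq_trans (@card_rank_maximal R d N r r_lt r_inj (Ordinal d0)).
have phi0 rho : phi rho ord0 ord0 = 0%E by rewrite mxE unlift_none.
have phij rho j : co (phi rho) j =
    \big[Order.min/+oo%E]_(p | (rho j <= r j p)%N) (f j p)%:E.
  by rewrite mxE liftK.
rewrite cardE -(size_map phi); apply: uniq_leq_size => // u uO'.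
have /sub [uG u0 umax] : [set` sO] u by [].
have [uT _] := uG; have uG' := (feasibleP _ uT u0).1 uG.
pose rho0 : {ffun 'I_d -> 'I_N.+1} :=
  [ffun j => inord #|[pred q | ((f j q)%:E < co u j)%E]|].
have rho0E j p : (rho0 j <= r j p)%N = (co u j <= (f j p)%:E)%E.
  rewrite ffunE inordK ?leq_rank// ltnS.
  by rewrite (leq_trans (max_card _))// card_ord.
have free0 : rank_free r rho0.
  apply/forallP => p; apply/existsP.
  have /uG'/not_belowP[j le] : [set` sG] (nth 0 sG p) by rewrite /= mem_nth.
  by exists j; rewrite rho0E.
have [rho mrho le] := ex_rank_maximal free0.
apply/mapP; exists rho; first by rewrite mem_enum.
(* Since [rho] lies above the rank vector of [u] and is free, [phi rho] is a feasible vector above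
   [u]; maximality of [u] gives equality. *)
apply/esym/umax => //; last first.
  move=> j; rewrite phij; apply: le_bigmin; first by rewrite leey.
  by move=> p lep; rewrite -rho0E (leq_trans (le j)).
have phiT : Tmin (phi rho).
  apply: Tmin_row => [|j]; first by rewrite phi0.
  rewrite phij -ltNye; by apply: lt_bigmin => [|p _]; rewrite ?ltNyr.
apply/feasibleP => // g gG; apply/not_belowP.
have gN : (index g sG < N)%N by rewrite index_mem.
have /andP[/forallP/(_ (Ordinal gN))/existsP[j lej] _] := mrho.
exists j; rewrite phij; apply: (@bigmin_inf _ _ _ _ (Ordinal gN)) => //.
by rewrite /f /= nth_index.
Qed.

End CountLocalUpperBounds.

(** * Staircases with many local upper bounds *)

Section Staircases.
Context (R : realType) (d k n : nat).
Context (dk : (d %/ 2)%N = k.+1) (n_gt0 : (0 < n)%N).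

Local Open Scope classical_set_scope.

Local Notation co x i := (x ord0 (lift ord0 i)).

(* The coordinates are grouped in pairs; the points with index congruent to [p]
   form a planar staircase in the [p]th pair and are low everywhere else. *)
Definition stair (i : nat) : 'rV[R]_d :=
  \row_c (if (c./2 == i %% k.+1)%N then (if odd c then - i%:R else i%:R) else - n%:R).

Definition stairs : set 'rV[R]_d := stair @` `I_n.

Lemma ex_coordinate (i : nat) (b : bool) : exists c : 'I_d,
  (c./2 = i %% k.+1)%N /\ odd c = b.
Proof.
have lt : (b + (i %% k.+1).*2 < d)%N.
  by have := ltn_pmod i (ltn0Sn k); have := leq_divM d 2; rewrite dk; case: b; lia.
exists (Ordinal lt) => /=; rewrite half_bit_double oddD odd_double addbF.
by case: b {lt}.
Qed.

Lemma stair_incomparable i j : (i < n)%N -> (j < n)%N -> i != j ->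
  exists c, stair j ord0 c < stair i ord0 c.
Proof.
move=> ilt jlt ij.
have [e|ne] := eqVneq (i %% k.+1)%N (j %% k.+1)%N.
  have [c [c2 oc]] := ex_coordinate i (i < j)%N; exists c.
  rewrite !mxE c2 -e eqxx oc; case: ltnP => lt; first by rewrite ltrN2 ltr_nat.
  by rewrite ltr_nat ltn_neqAle eq_sym ij.
have [c [c2 oc]] := ex_coordinate i false; exists c.
rewrite !mxE c2 eqxx (negPf ne) oc (@lt_le_trans _ _ 0)// oppr_lt0 ltr0n//.
Qed.

Lemma nondominated_stairs : nondominated stairs = stairs.
Proof.
apply/seteqP; split=> [z []//|_ [i ilt <-]]; split; first by exists i.
move=> [_ [[j jlt <-] le [l lt]]]; have [e|ij] := eqVneq j i.
  by move: lt; rewrite e ltxx.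
by have [c] := stair_incomparable jlt ilt ij; rewrite ltNge le.
Qed.

Lemma stairs_discrete : discrete_with stairs n.
Proof.
have card : (stairs #= `I_n)%card.
  apply: inj_card_eq => i j /set_mem ilt /set_mem jlt e.
  apply/eqP; apply: contrapT => /negP ij.
  by have [c] := stair_incomparable ilt jlt ij; rewrite e ltxx.
split; last by rewrite nondominated_stairs.
rewrite /discrete_problem nondominated_stairs; split; first by exists n.
by exists (stair 0), 0%N.
Qed.

Let m := (n %/ k.+1)%N.

(** In the staircase of residue [p], this is the corner between the points with quotients [s p] and
    [s p + 1]: the first supplies the odd coordinate, the second the even one. For odd [d] the last
    coordinate is unpaired, [inord] falls back to a default there, and only a value above [- n]
    matters. *)
Definition stair_gap (s : {ffun 'I_k.+1 -> 'I_m}) (c : 'I_d) : R :=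
  if odd c then - (s (inord c./2) * k.+1 + c./2)%:R
  else ((s (inord c./2)).+1 * k.+1 + c./2)%:R.

Lemma stair_gap_gt s c : - n%:R < stair_gap s c.
Proof.
rewrite /stair_gap; case: ifPn => oc; last first.
  by rewrite (@lt_le_trans _ _ 0)// oppr_lt0 ltr0n.
rewrite ltrN2 ltr_nat; set q := s _.
have c2 : (c./2 < k.+1)%N.
  rewrite -dk; have := ltn_ord c; have := odd_double_half c; rewrite oc.
  have := divn_eq d 2; have := ltn_pmod d (isT : 0 < 2)%N; lia.
have : (q.+1 * k.+1 <= m * k.+1)%N by rewrite leq_mul2r ltn_ord orbT.
have := leq_divM n k.+1; rewrite -/m mulSn; lia.
Qed.

Lemma ex_stair_local_upper_bound s : exists a,
  local_upper_bound stairs a /\ forall c, ((stair_gap s c)%:E <= co a c)%E.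
Proof.
pose x : 'rV[\bar R]_d.+1 :=
  \row_j (if unlift ord0 j is Some c then (stair_gap s c)%:E else 0%E).
have x0 : x ord0 ord0 = 0%E by rewrite mxE unlift_none.
have xc c : co x c = (stair_gap s c)%:E by rewrite mxE liftK.
have fin : finite_set stairs by have [[]] := stairs_discrete; rewrite nondominated_stairs.
suff xG : feasible stairs x.
  have [a aG xa] := ex_local_upper_bound fin xG x0.
  by exists a; split=> // c; rewrite -xc; exact: xa.
have xT : Tmin x by apply: Tmin_row => [|c]; rewrite ?x0 ?xc.
apply/feasibleP => // _ [i ilt <-]; apply/not_belowP.
pose q := s (inord (i %% k.+1)).
have [c [c2 oc]] := ex_coordinate i (i %/ k.+1 <= q)%N; exists c.
rewrite xc lee_fin mxE /stair_gap c2 eqxx oc -/q [in i%:R](divn_eq i k.+1).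
case: leqP => le.
  by rewrite lerN2 ler_nat leq_add2r leq_mul2r le orbT.
by rewrite ler_nat leq_add2r leq_mul2r le orbT.
Qed.

(** The point of residue [p] and quotient [s' p] lies strictly below any vector above both corners.
    Hence different gaps lead to different local upper bounds. *)
Lemma stair_gap_lt (s s' : {ffun 'I_k.+1 -> 'I_m}) p (a : 'rV[\bar R]_d.+1) : (s p < s' p)%N ->
  (forall c, ((stair_gap s c)%:E <= co a c)%E) ->
  (forall c, ((stair_gap s' c)%:E <= co a c)%E) -> ~ local_upper_bound stairs a.
Proof.
move=> lt sa s'a [aG a0 _]; have [aT _] := aG.
pose i := (s' p * k.+1 + p)%N.
have ip : (i %% k.+1)%N = p by rewrite /i modnMDl modn_small.
have ilt : (i < n)%N.
  have : ((s' p).+1 * k.+1 <= m * k.+1)%N by rewrite leq_mul2r ltn_ord orbT.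
  by have := leq_divM n k.+1; have := ltn_ord p; rewrite -/m mulSn /i; lia.
apply: ((feasibleP stairs aT a0).1 aG (stair i)); first by exists i.
move=> c; rewrite mxE ip; case: eqVneq => [cp|_].
  case: ifP => oc.
    apply: lt_le_trans (sa c); rewrite lte_fin /stair_gap oc cp inord_val.
    by rewrite ltrN2 ltr_nat ltn_add2r ltn_mul2r.
  apply: lt_le_trans (s'a c); rewrite lte_fin /stair_gap oc cp inord_val.
  by rewrite ltr_nat ltn_add2r ltn_mul2r ltnSn.
by apply: lt_le_trans (sa c); rewrite lte_fin stair_gap_gt.
Qed.

Lemma ex_many_local_upper_bounds : exists sO : seq 'rV[\bar R]_d.+1,
  [/\ uniq sO, [set` sO] `<=` local_upper_bound stairs & size sO = (m ^ k.+1)%N].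
Proof.
have [a aP] := choice ex_stair_local_upper_bound.
have a_inj : injective a.
  have no (s s' : {ffun 'I_k.+1 -> 'I_m}) p : a s = a s' -> ~ (s p < s' p)%N.
    move=> e lt; have [aG sa] := aP s; have [_ s'a] := aP s'.
    by move: s'a; rewrite -e => s'a; exact: (stair_gap_lt lt sa s'a aG).
  move=> s s' e; apply/ffunP => p; apply/val_inj => /=.
  have := no s s' p e; have := no s' s p (esym e).
  by case: ltngtP.
exists [seq a s | s <- enum {ffun 'I_k.+1 -> 'I_m}]; split.
- by rewrite map_inj_uniq ?enum_uniq.
- by move=> _ /mapP[s _ ->]; exact: (aP s).1.
- by rewrite size_map -cardE card_ffun !card_ord.
Qed.

End Staircases.

(** * The maximal number of scalarizations *)

Lemma leq_wexpn2r m n e : (m <= n -> m ^ e <= n ^ e)%N.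
Proof. by case: e => // e; rewrite leq_exp2r. Qed.

Section CountScalarizations.
Context {R : realType} {d : nat}.
Context (pick : set 'rV[R]_d -> state R d -> 'rV[\bar R]_d.+1).
Context (oracle : set 'rV[R]_d -> 'rV[\bar R]_d.+1 -> option 'rV[R]_d).
Context (d0 : (0 < d)%N) (hpick : is_pick_rule pick).
Context (horacle : is_NextNonDominated oracle).

Local Open Scope classical_set_scope.

Definition count_bound (n : nat) : nat := (2 * 2 ^ d * (n + d) ^ (d %/ 2))%N.

Lemma scalarizations_le Z n k : discrete_with Z n ->
  scalarizations pick oracle Z k -> (k <= n + count_bound n)%N.
Proof.
move=> Zn /(scalarizationsP d0 hpick horacle Zn)[sO [uO OE ->]].
have [_ /ex_enum_card[sN [_ szN NE]]] := Zn.
rewrite leq_add2l /count_bound -szN.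
by apply: card_local_upper_bounds => //; rewrite OE NE.
Qed.

Lemma scalarizations_exist Z n : discrete_with Z n ->
  exists k, scalarizations pick oracle Z k.
Proof.
move=> Zn; apply: (ex_scalarizations (K := count_bound n) d0 hpick horacle Zn).
move=> sG sO sz uO sub; apply: leq_trans (card_local_upper_bounds d0 uO sub) _.
by rewrite /count_bound leq_mul2l leq_wexpn2r ?orbT// leq_add2r.
Qed.

Lemma discrete_with_gt0 (Z : set 'rV[R]_d) n : discrete_with Z n -> (0 < n)%N.
Proof.
move=> [[_ [z Zz]] /ex_enum_card[s [_ <- NE]]].
by move: Zz; rewrite NE; case: s {NE}.
Qed.

(** For [d = 1] the exponent [d / 2] vanishes, so the [n] calls that find points must be bounded by
    a constant. *)
Lemma discrete_with_line (Z : set 'rV[R]_d) n : d = 1%N -> discrete_with Z n -> n = 1%N.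
Proof.
move=> d1 Zn; have n0 := discrete_with_gt0 Zn.
have [_ /ex_enum_card[s [us szs NE]]] := Zn.
case: s us szs NE => [|z [|w s]] us szs NE; [by rewrite -szs in n0|by []|].
have nz : nondominated Z z by rewrite NE /= inE eqxx.
have nw : nondominated Z w by rewrite NE /= !inE eqxx orbT.
have zw : z != w by move: us => /=; rewrite inE negb_or => /andP[/andP[]].
have wz : w != z by rewrite eq_sym.
have [i zi] := nondominated_incomparable nz nw zw.
have [j wj] := nondominated_incomparable nw nz wz.
have ij : i = j by apply/val_inj => /=; have := ltn_ord i; have := ltn_ord j; lia.
by move: wj; rewrite -ij => /(lt_trans zi); rewrite ltxx.
Qed.

Lemma ex_max_scalarizations n : admissible R d n ->
  exists m, is_max_scalarizations pick oracle n m.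
Proof.
move=> [Z0 Z0n].
pose P m := `[< exists2 Z, discrete_with Z n & scalarizations pick oracle Z m >].
have exP : exists m, P m.
  by have [k sk] := scalarizations_exist Z0n; exists k; apply/asboolP; exists Z0.
have ubP m : P m -> (m <= n + count_bound n)%N.
  by move=> /asboolP[Z Zn sm]; exact: scalarizations_le Zn sm.
case: (ex_maxnP exP ubP) => m /asboolP Pm mx; exists m; split=> // Z Zn.
have [k sk] := scalarizations_exist Zn; exists k => //.
by apply: mx; apply/asboolP; exists Z.
Qed.

Lemma max_scalarizations_ge n m Z (sO : seq 'rV[\bar R]_d.+1) :
  is_max_scalarizations pick oracle n m -> discrete_with Z n -> uniq sO ->
  [set` sO] `<=` local_upper_bound (nondominated Z) -> (n + size sO <= m)%N.
Proof.
move=> [_ mx] Zn uO sub; have [k sk km] := mx Z Zn.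
have [sO' [uO' OE kE]] := scalarizationsP d0 hpick horacle Zn sk.
apply: leq_trans km; rewrite kE leq_add2l; apply: uniq_leq_size => // a /sub.
by rewrite -OE.
Qed.

Lemma max_scalarizations_upper n m :
  is_max_scalarizations pick oracle n m ->
  (m <= (1 + 2 * 2 ^ d * d.+1 ^ (d %/ 2)) * n ^ (d %/ 2))%N.
Proof.
move=> [[Z Zn sm] _].
have n0 := discrete_with_gt0 Zn.
have le_n : (n <= n ^ (d %/ 2))%N.
  have [d1|d2] := leqP d 1; last by rewrite -[X in (X <= _)%N]expn1 leq_pexp2l// divn_gt0.
  have d1' : d = 1%N by apply/eqP; rewrite eqn_leq d1.
  by rewrite (discrete_with_line d1' Zn) exp1n.
apply: leq_trans (scalarizations_le Zn sm) _.
rewrite mulnDl mul1n leq_add// /count_bound -[X in (_ <= X)%N]mulnA -expnMn leq_mul2l.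
(* As [n] is positive, [n + d <= (d + 1) * n]. *)
apply/orP; right; apply: leq_wexpn2r; rewrite mulSn leq_add2l.
by rewrite leq_pmulr.
Qed.

Lemma max_scalarizations_lower n m : admissible R d n ->
  is_max_scalarizations pick oracle n m ->
  (n ^ (d %/ 2) <= (2 * (d %/ 2)).+1 ^ (d %/ 2) * m)%N.
Proof.
move=> [Z Zn] mx; have n0 := discrete_with_gt0 Zn.
have nm : (n <= m)%N.
  by have := max_scalarizations_ge (sO := [::]) mx Zn isT (fun _ => _);
     rewrite addn0; apply.
have m0 : (0 < m)%N by apply: leq_trans nm.
case dk : (d %/ 2)%N => [|k]; first by rewrite !expn0 mul1n.
have [sO [uO sub sz]] := ex_many_local_upper_bounds R dk n0.
have := max_scalarizations_ge (Z := stairs k n) mx (stairs_discrete R dk n0) uO.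
rewrite nondominated_stairs// => /(_ sub); rewrite sz => le.
(* For [n <= k] the quotient [n / (k + 1)] is zero and the constant alone suffices; otherwise [n] is
   at most [2 * (k + 1)] times that quotient. *)
have [nk|kn] := ltnP n k.+1.
  apply: (@leq_trans (k.+1 ^ k.+1)).
    by apply: leq_wexpn2r; exact: ltnW.
  apply: (@leq_trans ((2 * k.+1).+1 ^ k.+1)); last by rewrite leq_pmulr.
  by apply: leq_wexpn2r; lia.
apply: (@leq_trans ((2 * k.+1).+1 ^ k.+1 * (n %/ k.+1) ^ k.+1)); last first.
  by rewrite leq_mul2l (leq_trans _ le) ?leq_addl ?orbT.
rewrite -expnMn; apply: leq_wexpn2r.
have : (0 < n %/ k.+1)%N by rewrite divn_gt0.
have := divn_eq n k.+1; have := ltn_pmod n (ltn0Sn k).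
by set q := (n %/ _)%N; nia.
Qed.

End CountScalarizations.

Theorem corollary23 (R : realType) (d : nat) (hd : (1 <= d)%N)
    (pick : set 'rV[R]_d -> state R d -> 'rV[\bar R]_d.+1)
    (oracle : set 'rV[R]_d -> 'rV[\bar R]_d.+1 -> option 'rV[R]_d)
    (hpick : is_pick_rule pick) (horacle : is_NextNonDominated oracle) :
  exists f : nat -> nat,
    (forall n : nat, admissible R d n ->
       is_max_scalarizations pick oracle n (f n)) /\
    Theta_on R (admissible R d) f (fun n : nat => (n ^ (d %/ 2))%N).
Proof.
have ex_f n : exists m, admissible R d n -> is_max_scalarizations pick oracle n m.
  have [/(ex_max_scalarizations hd hpick horacle)[m mP]|no] := pselect (admissible R d n).
    by exists m.
  by exists 0%N => /no.
have [f fP] := choice ex_f; exists f; split=> //.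
pose c1 := ((2 * (d %/ 2)).+1 ^ (d %/ 2))%N.
pose c2 := (1 + 2 * 2 ^ d * d.+1 ^ (d %/ 2))%N.
have c1_gt0 : 0 < c1%:R :> R by rewrite ltr0n expn_gt0.
exists c1%:R^-1, c2%:R; split; [by rewrite invr_gt0|by rewrite ltr0n|].
move=> n nP; have mx := fP n nP; split.
  rewrite mulrC ler_pdivrMr// mulrC -natrM ler_nat.
  exact: max_scalarizations_lower hd hpick horacle _ _ nP mx.
rewrite -natrM ler_nat.
exact: max_scalarizations_upper hd hpick horacle _ _ mx.
Qed.
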